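(* Let $(\mathbb{X}, \otimes, K)$ be a linear category with monoidal coalgebra modality $(!, \delta, \varepsilon, \Delta, \mathsf{e}, \mathsf{m},\mathsf{m}_K)$ such that $(\mathbb{X}, \otimes, K)$ is also an additive symmetric monoidal category with negatives. Then for every object $A$, the symmetric comonoidal monad $(!(A) \otimes -, \mu^{\nabla_A}, \eta^{\mathsf{u}_A}, \mathsf{n}^{\Delta_A}, \mathsf{n}^{\mathsf{e}_A}_K)$ together with $\lambda_X:=(\delta_A\otimes 1_{!(X)});\mathsf{m}_{!(A),X}: !(A)\otimes!(X)\to !(!(A)\otimes X)$ is a $\mathsf{MELL}$ lifting monad, and therefore the category $\mathsf{MOD}(!(A), \nabla_A, \mathsf{u}_A)$ of $(!(A),\nabla_A,\mathsf{u}_A)$-modules, with tensor $(M,\nu)\otimes(N,\nu')=(M\otimes N,\mathsf{n}^{\Delta_A}_{M,N};(\nu\otimes\nu'))$ and unit $(K,\mathsf{n}^{\mathsf{e}_A}_K)$, is a linear category.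
   Context: Composition is in diagrammatic order; $\alpha,\ell,\rho$ are associator and unitors and $\tau$ the interchange $(A\otimes B)\otimes(C\otimes D)\to(A\otimes C)\otimes(B\otimes D)$. A linear category is a symmetric monoidal closed category with a monoidal coalgebra modality: a symmetric monoidal comonad $(!,\delta,\varepsilon,\mathsf{m},\mathsf{m}_K)$ ($\mathsf{m}_{A,B}:!(A)\otimes!(B)\to!(A\otimes B)$, $\mathsf{m}_K:K\to!(K)$) with natural cocommutative comonoids $(!(A),\Delta_A,\mathsf{e}_A)$ such that $\delta_A$ is a comonoid morphism and $\Delta,\mathsf{e}$ are monoidal transformations and $!$-coalgebra morphisms. Additive symmetric monoidal with negatives means hom-sets are abelian groups with composition and $\otimes$ bilinear. $\nabla_A := (\delta_A\otimes\delta_A);\mathsf{m}_{!(A),!(A)};!\big(((\varepsilon_A\otimes\mathsf{e}_A);\rho_A)+((\mathsf{e}_A\otimes\varepsilon_A);\ell_A)\big)$, $\mathsf{u}_A:=\mathsf{m}_K;!(0_{K,A})$; the monad is $\mu_X=\alpha_{!(A),!(A),X};(\nabla_A\otimes1_X)$, $\eta_X=\ell^{-1}_X;(\mathsf{u}_A\otimes1_X)$, $\mathsf{n}^{\Delta_A}_{X,Y}=(\Delta_A\otimes1_{X\otimes Y});\tau_{!(A),!(A),X,Y}$, $\mathsf{n}^{\mathsf{e}_A}_K=\rho_{!(A)};\mathsf{e}_A$. A $\mathsf{MELL}$ lifting monad is a symmetric comonoidal monad $(\mathsf{T},\mu,\eta,\mathsf{n},\mathsf{n}_K)$ whose fusion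 operators $\mathsf{n}_{B,\mathsf{T}(C)};(1\otimes\mu_C)$ and $\mathsf{n}_{\mathsf{T}(B),C};(\mu_B\otimes1)$ are invertible, with a natural $\lambda_X:\mathsf{T}!(X)\to!\mathsf{T}(X)$ satisfying $\mu_{!(X)};\lambda_X=\mathsf{T}(\lambda_X);\lambda_{\mathsf{T}(X)};!(\mu_X)$, $\eta_{!(X)};\lambda_X=!(\eta_X)$, $\mathsf{T}(\delta_X);\lambda_{!(X)};!(\lambda_X)=\lambda_X;\delta_{\mathsf{T}(X)}$, $\lambda_X;\varepsilon_{\mathsf{T}(X)}=\mathsf{T}(\varepsilon_X)$, $\mathsf{n}_{!(X),!(Y)};(\lambda_X\otimes\lambda_Y);\mathsf{m}_{\mathsf{T}(X),\mathsf{T}(Y)}=\mathsf{T}(\mathsf{m}_{X,Y});\lambda_{X\otimes Y};!(\mathsf{n}_{X,Y})$, $\mathsf{n}_K;\mathsf{m}_K=\mathsf{T}(\mathsf{m}_K);\lambda_K;!(\mathsf{n}_K)$. *)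

(* Defs.v *)
From Stdlib Require Import ProofIrrelevance.

Declare Scope cat_scope.
Delimit Scope cat_scope with cat.
Open Scope cat_scope.

(* Categories; composition is written in DIAGRAMMATIC order: f >>> g   *)
(* means "first f, then g".                                            *)
Record Category := {
  ob :> Type;
  hom : ob -> ob -> Type;
  idm : forall A : ob, hom A A;
  comp : forall {A B D : ob}, hom A B -> hom B D -> hom A D;
  comp_id_l : forall (A B : ob) (f : hom A B), comp (idm A) f = f;
  comp_id_r : forall (A B : ob) (f : hom A B), comp f (idm B) = f;
  comp_assoc : forall (A B D E : ob) (f : hom A B) (g : hom B D) (h : hom D E),
      comp (comp f g) h = comp f (comp g h)
}.
Arguments hom {c} _ _.
Arguments idm {c} _.
Arguments comp {c A B D} _ _.
Notation "f >>> g" := (comp f g) (at level 40, left associativity) : cat_scope.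

(* heterogeneous equality of morphisms (used to compare morphisms whose
   domain/codomain are only propositionally equal) *)
Definition hom_heq {C : Category} {a b a' b' : C} (f : hom a b) (g : hom a' b') : Prop :=
  existT (fun p : C * C => hom (fst p) (snd p)) (a, b) f
  = existT (fun p : C * C => hom (fst p) (snd p)) (a', b') g.

Section MonoidalDef.
Context (C : Category).

Record MonoidalStr := {
  tens : C -> C -> C;
  tensm : forall {A B A' B' : C}, hom A A' -> hom B B' -> hom (tens A B) (tens A' B');
  munit : C;
  assoc : forall A B D : C, hom (tens (tens A B) D) (tens A (tens B D));
  assoc_inv : forall A B D : C, hom (tens A (tens B D)) (tens (tens A B) D);
  lu : forall A : C, hom (tens munit A) A;
  lu_inv : forall A : C, hom A (tens munit A);
  ru : forall A : C, hom (tens A munit) A;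
  ru_inv : forall A : C, hom A (tens A munit);
  tens_id : forall A B : C, tensm (idm A) (idm B) = idm (tens A B);
  tens_comp : forall (A1 A2 A3 B1 B2 B3 : C) (f1 : hom A1 A2) (f2 : hom A2 A3)
      (g1 : hom B1 B2) (g2 : hom B2 B3),
      tensm (f1 >>> f2) (g1 >>> g2) = tensm f1 g1 >>> tensm f2 g2;
  assoc_nat : forall (A A' B B' D D' : C) (f : hom A A') (g : hom B B') (h : hom D D'),
      tensm (tensm f g) h >>> assoc A' B' D' = assoc A B D >>> tensm f (tensm g h);
  lu_nat : forall (A B : C) (f : hom A B), tensm (idm munit) f >>> lu B = lu A >>> f;
  ru_nat : forall (A B : C) (f : hom A B), tensm f (idm munit) >>> ru B = ru A >>> f;
  assoc_iso1 : forall A B D : C, assoc A B D >>> assoc_inv A B D = idm _;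
  assoc_iso2 : forall A B D : C, assoc_inv A B D >>> assoc A B D = idm _;
  lu_iso1 : forall A : C, lu A >>> lu_inv A = idm _;
  lu_iso2 : forall A : C, lu_inv A >>> lu A = idm _;
  ru_iso1 : forall A : C, ru A >>> ru_inv A = idm _;
  ru_iso2 : forall A : C, ru_inv A >>> ru A = idm _;
  pentagon : forall A B D E : C,
      tensm (assoc A B D) (idm E) >>> assoc A (tens B D) E >>> tensm (idm A) (assoc B D E)
      = assoc (tens A B) D E >>> assoc A B (tens D E);
  triangle : forall A B : C,
      assoc A munit B >>> tensm (idm A) (lu B) = tensm (ru A) (idm B)
}.
End MonoidalDef.

Arguments tens {C} _ _ _.
Arguments tensm {C} _ {A B A' B'} _ _.
Arguments munit {C} _.
Arguments assoc {C} _ _ _ _.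
Arguments assoc_inv {C} _ _ _ _.
Arguments lu {C} _ _.
Arguments lu_inv {C} _ _.
Arguments ru {C} _ _.
Arguments ru_inv {C} _ _.

Section MonStructures.
Context {C : Category} (M : MonoidalStr C).
Local Notation "A ⊗ B" := (tens M A B) (at level 30, right associativity).
Local Notation "f ⊗m g" := (tensm M f g) (at level 30, right associativity).
Local Notation K := (munit M).

Record SymmetryStr := {
  sym : forall A B : C, hom (A ⊗ B) (B ⊗ A);
  sym_nat : forall (A A' B B' : C) (f : hom A A') (g : hom B B'),
      (f ⊗m g) >>> sym A' B' = sym A B >>> (g ⊗m f);
  sym_invol : forall A B : C, sym A B >>> sym B A = idm _;
  hexagon : forall A B D : C,
      assoc M A B D >>> sym A (B ⊗ D) >>> assoc M B D A
      = (sym A B ⊗m idm D) >>> assoc M B A D >>> (idm B ⊗m sym A D)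
}.

Record ClosedStr := {
  ihom : C -> C -> C;
  ev : forall A B : C, hom (ihom A B ⊗ A) B;
  curry : forall {X A B : C}, hom (X ⊗ A) B -> hom X (ihom A B);
  curry_ev : forall (X A B : C) (f : hom (X ⊗ A) B),
      (curry f ⊗m idm A) >>> ev A B = f;
  curry_uniq : forall (X A B : C) (f : hom (X ⊗ A) B) (g : hom X (ihom A B)),
      (g ⊗m idm A) >>> ev A B = f -> g = curry f
}.

Record AdditiveStr := {
  hadd : forall {A B : C}, hom A B -> hom A B -> hom A B;
  hzero : forall A B : C, hom A B;
  hneg : forall {A B : C}, hom A B -> hom A B;
  hadd_assoc : forall (A B : C) (f g h : hom A B), hadd (hadd f g) h = hadd f (hadd g h);
  hadd_comm : forall (A B : C) (f g : hom A B), hadd f g = hadd g f;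
  hadd_0 : forall (A B : C) (f : hom A B), hadd (hzero A B) f = f;
  hadd_neg : forall (A B : C) (f : hom A B), hadd (hneg f) f = hzero A B;
  comp_addl : forall (A B D : C) (f g : hom A B) (h : hom B D),
      hadd f g >>> h = hadd (f >>> h) (g >>> h);
  comp_addr : forall (A B D : C) (h : hom A B) (f g : hom B D),
      h >>> hadd f g = hadd (h >>> f) (h >>> g);
  comp_0l : forall (A B D : C) (h : hom B D), hzero A B >>> h = hzero A D;
  comp_0r : forall (A B D : C) (h : hom A B), h >>> hzero B D = hzero A D;
  tens_addl : forall (A A' B B' : C) (f g : hom A A') (h : hom B B'),
      (hadd f g ⊗m h) = hadd (f ⊗m h) (g ⊗m h);
  tens_addr : forall (A A' B B' : C) (h : hom A A') (f g : hom B B'),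
      (h ⊗m hadd f g) = hadd (h ⊗m f) (h ⊗m g);
  tens_0l : forall (A A' B B' : C) (h : hom B B'), (hzero A A' ⊗m h) = hzero _ _;
  tens_0r : forall (A A' B B' : C) (h : hom A A'), (h ⊗m hzero B B') = hzero _ _
}.
End MonStructures.

Arguments sym {C M} _ _ _.
Arguments ihom {C M} _ _ _.
Arguments ev {C M} _ _ _.
Arguments curry {C M} _ {X A B} _.
Arguments hadd {C M} _ {A B} _ _.
Arguments hzero {C M} _ _ _.
Arguments hneg {C M} _ {A B} _.

Definition tau {C : Category} {M : MonoidalStr C} (S : SymmetryStr M) (A B D E : C)
  : hom (tens M (tens M A B) (tens M D E)) (tens M (tens M A D) (tens M B E)) :=
  assoc M A B (tens M D E)
  >>> tensm M (idm A) (assoc_inv M B D E)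
  >>> tensm M (idm A) (tensm M (sym S B D) (idm E))
  >>> tensm M (idm A) (assoc M D B E)
  >>> assoc_inv M A D (tens M B E).

Section ModalityDef.
Context {C : Category} {M : MonoidalStr C} (S : SymmetryStr M).
Local Notation "A ⊗ B" := (tens M A B) (at level 30, right associativity).
Local Notation "f ⊗m g" := (tensm M f g) (at level 30, right associativity).
Local Notation K := (munit M).

Record ModalityStr := {
  bang : C -> C;
  bangm : forall {A B : C}, hom A B -> hom (bang A) (bang B);
  bang_id : forall A : C, bangm (idm A) = idm (bang A);
  bang_comp : forall (A B D : C) (f : hom A B) (g : hom B D),
      bangm (f >>> g) = bangm f >>> bangm g;
  delta : forall A : C, hom (bang A) (bang (bang A));
  eps : forall A : C, hom (bang A) A;
  delta_nat : forall (A B : C) (f : hom A B),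
      bangm f >>> delta B = delta A >>> bangm (bangm f);
  eps_nat : forall (A B : C) (f : hom A B), bangm f >>> eps B = eps A >>> f;
  comonad_counit1 : forall A : C, delta A >>> eps (bang A) = idm _;
  comonad_counit2 : forall A : C, delta A >>> bangm (eps A) = idm _;
  comonad_coassoc : forall A : C, delta A >>> delta (bang A) = delta A >>> bangm (delta A);
  mm : forall A B : C, hom (bang A ⊗ bang B) (bang (A ⊗ B));
  mK : hom K (bang K);
  mm_nat : forall (A A' B B' : C) (f : hom A A') (g : hom B B'),
      (bangm f ⊗m bangm g) >>> mm A' B' = mm A B >>> bangm (f ⊗m g);
  mm_assoc : forall A B D : C,
      (mm A B ⊗m idm (bang D)) >>> mm (A ⊗ B) D >>> bangm (assoc M A B D)
      = assoc M (bang A) (bang B) (bang D) >>> (idm (bang A) ⊗m mm B D) >>> mm A (B ⊗ D);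
  mm_lunit : forall A : C,
      (mK ⊗m idm (bang A)) >>> mm K A >>> bangm (lu M A) = lu M (bang A);
  mm_runit : forall A : C,
      (idm (bang A) ⊗m mK) >>> mm A K >>> bangm (ru M A) = ru M (bang A);
  mm_sym : forall A B : C, sym S (bang A) (bang B) >>> mm B A = mm A B >>> bangm (sym S A B);
  eps_monoidal : forall A B : C, mm A B >>> eps (A ⊗ B) = (eps A ⊗m eps B);
  eps_monoidalK : mK >>> eps K = idm K;
  delta_monoidal : forall A B : C,
      mm A B >>> delta (A ⊗ B)
      = (delta A ⊗m delta B) >>> mm (bang A) (bang B) >>> bangm (mm A B);
  delta_monoidalK : mK >>> delta K = mK >>> bangm mK;
  cdup : forall A : C, hom (bang A) (bang A ⊗ bang A);
  cerase : forall A : C, hom (bang A) K;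
  cdup_nat : forall (A B : C) (f : hom A B), bangm f >>> cdup B = cdup A >>> (bangm f ⊗m bangm f);
  cerase_nat : forall (A B : C) (f : hom A B), bangm f >>> cerase B = cerase A;
  cdup_coassoc : forall A : C,
      cdup A >>> (cdup A ⊗m idm (bang A)) >>> assoc M _ _ _ = cdup A >>> (idm (bang A) ⊗m cdup A);
  cdup_lcounit : forall A : C, cdup A >>> (cerase A ⊗m idm (bang A)) >>> lu M _ = idm _;
  cdup_rcounit : forall A : C, cdup A >>> (idm (bang A) ⊗m cerase A) >>> ru M _ = idm _;
  cdup_cocomm : forall A : C, cdup A >>> sym S _ _ = cdup A;
  delta_cdup : forall A : C, delta A >>> cdup (bang A) = cdup A >>> (delta A ⊗m delta A);
  delta_cerase : forall A : C, delta A >>> cerase (bang A) = cerase A;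
  cdup_monoidal : forall A B : C,
      mm A B >>> cdup (A ⊗ B)
      = (cdup A ⊗m cdup B) >>> tau S _ _ _ _ >>> (mm A B ⊗m mm A B);
  cdup_monoidalK : mK >>> cdup K = lu_inv M K >>> (mK ⊗m mK);
  cerase_monoidal : forall A B : C,
      mm A B >>> cerase (A ⊗ B) = (cerase A ⊗m cerase B) >>> lu M K;
  cerase_monoidalK : mK >>> cerase K = idm K;
  cdup_coalg : forall A : C,
      cdup A >>> (delta A ⊗m delta A) >>> mm (bang A) (bang A) = delta A >>> bangm (cdup A);
  cerase_coalg : forall A : C, cerase A >>> mK = delta A >>> bangm (cerase A)
}.
End ModalityDef.

Arguments bang {C M S} _ _.
Arguments bangm {C M S} _ {A B} _.
Arguments delta {C M S} _ _.
Arguments eps {C M S} _ _.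
Arguments mm {C M S} _ _ _.
Arguments mK {C M S} _.
Arguments cdup {C M S} _ _.
Arguments cerase {C M S} _ _.

Record LinearCategory (C : Category) := {
  lc_mon : MonoidalStr C;
  lc_sym : SymmetryStr lc_mon;
  lc_closed : ClosedStr lc_mon;
  lc_modality : ModalityStr lc_sym
}.

Section MELLDef.
Context {C : Category} {M : MonoidalStr C} {S : SymmetryStr M} (L : ModalityStr S).
Local Notation "A ⊗ B" := (tens M A B) (at level 30, right associativity).
Local Notation "f ⊗m g" := (tensm M f g) (at level 30, right associativity).
Local Notation K := (munit M).
Local Notation "! A" := (bang L A) (at level 20).
Local Notation "!m f" := (bangm L f) (at level 20).

Definition is_iso {A B : C} (f : hom A B) : Prop :=
  exists g : hom B A, f >>> g = idm A /\ g >>> f = idm B.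

Record IsMELLLiftingMonad
  (T : C -> C) (Tm : forall A B : C, hom A B -> hom (T A) (T B))
  (mu : forall X : C, hom (T (T X)) (T X)) (eta : forall X : C, hom X (T X))
  (n : forall X Y : C, hom (T (X ⊗ Y)) (T X ⊗ T Y)) (nK : hom (T K) K)
  (lam : forall X : C, hom (T (! X)) (! (T X))) : Prop := {
  T_id : forall A : C, Tm A A (idm A) = idm (T A);
  T_comp : forall (A B D : C) (f : hom A B) (g : hom B D),
      Tm A D (f >>> g) = Tm A B f >>> Tm B D g;
  mu_nat : forall (A B : C) (f : hom A B), Tm _ _ (Tm A B f) >>> mu B = mu A >>> Tm A B f;
  eta_nat : forall (A B : C) (f : hom A B), f >>> eta B = eta A >>> Tm A B f;
  monad_assoc : forall X : C, mu (T X) >>> mu X = Tm _ _ (mu X) >>> mu X;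
  monad_unit1 : forall X : C, eta (T X) >>> mu X = idm (T X);
  monad_unit2 : forall X : C, Tm _ _ (eta X) >>> mu X = idm (T X);
  n_nat : forall (A A' B B' : C) (f : hom A A') (g : hom B B'),
      Tm _ _ (f ⊗m g) >>> n A' B' = n A B >>> (Tm A A' f ⊗m Tm B B' g);
  n_assoc : forall X Y Z : C,
      Tm _ _ (assoc M X Y Z) >>> n X (Y ⊗ Z) >>> (idm (T X) ⊗m n Y Z)
      = n (X ⊗ Y) Z >>> (n X Y ⊗m idm (T Z)) >>> assoc M (T X) (T Y) (T Z);
  n_lunit : forall X : C, n K X >>> (nK ⊗m idm (T X)) >>> lu M (T X) = Tm _ _ (lu M X);
  n_runit : forall X : C, n X K >>> (idm (T X) ⊗m nK) >>> ru M (T X) = Tm _ _ (ru M X);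
  n_sym : forall X Y : C, Tm _ _ (sym S X Y) >>> n Y X = n X Y >>> sym S (T X) (T Y);
  mu_comonoidal : forall X Y : C,
      mu (X ⊗ Y) >>> n X Y = Tm _ _ (n X Y) >>> n (T X) (T Y) >>> (mu X ⊗m mu Y);
  mu_comonoidalK : mu K >>> nK = Tm _ _ nK >>> nK;
  eta_comonoidal : forall X Y : C, eta (X ⊗ Y) >>> n X Y = (eta X ⊗m eta Y);
  eta_comonoidalK : eta K >>> nK = idm K;
  fusion_left_iso : forall B D : C, is_iso (n B (T D) >>> (idm (T B) ⊗m mu D));
  fusion_right_iso : forall B D : C, is_iso (n (T B) D >>> (mu B ⊗m idm (T D)));
  lam_nat : forall (X Y : C) (f : hom X Y), Tm _ _ (!m f) >>> lam Y = lam X >>> !m (Tm X Y f);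
  lam_mu : forall X : C, mu (! X) >>> lam X = Tm _ _ (lam X) >>> lam (T X) >>> !m (mu X);
  lam_eta : forall X : C, eta (! X) >>> lam X = !m (eta X);
  lam_delta : forall X : C,
      Tm _ _ (delta L X) >>> lam (! X) >>> !m (lam X) = lam X >>> delta L (T X);
  lam_eps : forall X : C, lam X >>> eps L (T X) = Tm _ _ (eps L X);
  lam_mm : forall X Y : C,
      n (! X) (! Y) >>> (lam X ⊗m lam Y) >>> mm L (T X) (T Y)
      = Tm _ _ (mm L X Y) >>> lam (X ⊗ Y) >>> !m (n X Y);
  lam_mK : nK >>> mK L = Tm _ _ (mK L) >>> lam K >>> !m nK
}.
End MELLDef.

Section BangMonad.
Context {C : Category} {M : MonoidalStr C} {S : SymmetryStr M} (L : ModalityStr S)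
        (Ad : AdditiveStr M) (A : C).
Local Notation "A ⊗ B" := (tens M A B) (at level 30, right associativity).
Local Notation "f ⊗m g" := (tensm M f g) (at level 30, right associativity).
Local Notation K := (munit M).
Local Notation "! A" := (bang L A) (at level 20).
Local Notation "!m f" := (bangm L f) (at level 20).

Definition nablaA : hom (! A ⊗ ! A) (! A) :=
  (delta L A ⊗m delta L A) >>> mm L (! A) (! A)
  >>> !m (hadd Ad ((eps L A ⊗m cerase L A) >>> ru M A)
                  ((cerase L A ⊗m eps L A) >>> lu M A)).

Definition uA : hom K (! A) := mK L >>> !m (hzero Ad K A).

Definition TA (X : C) : C := ! A ⊗ X.
Definition TmA (X Y : C) (f : hom X Y) : hom (TA X) (TA Y) := idm (! A) ⊗m f.
(* alpha^{-1} is needed for the composite to typecheck *)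
Definition muA (X : C) : hom (TA (TA X)) (TA X) :=
  assoc_inv M (! A) (! A) X >>> (nablaA ⊗m idm X).
Definition etaA (X : C) : hom X (TA X) := lu_inv M X >>> (uA ⊗m idm X).
Definition nA (X Y : C) : hom (TA (X ⊗ Y)) (TA X ⊗ TA Y) :=
  (cdup L A ⊗m idm (X ⊗ Y)) >>> tau S (! A) (! A) X Y.
Definition nKA : hom (TA K) K := ru M (! A) >>> cerase L A.
Definition lamA (X : C) : hom (TA (! X)) (! (TA X)) :=
  (delta L A ⊗m idm (! X)) >>> mm L (! A) X.
End BangMonad.

Section ModCat.
Context {C : Category} (M : MonoidalStr C) (R : C)
        (mult : hom (tens M R R) R) (un : hom (munit M) R).
Local Notation "A ⊗ B" := (tens M A B) (at level 30, right associativity).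
Local Notation "f ⊗m g" := (tensm M f g) (at level 30, right associativity).

Record ModOb := {
  mcar : C;
  mact : hom (R ⊗ mcar) mcar;
  mact_unit : lu_inv M mcar >>> (un ⊗m idm mcar) >>> mact = idm mcar;
  mact_assoc : assoc_inv M R R mcar >>> (mult ⊗m idm mcar) >>> mact
               = (idm R ⊗m mact) >>> mact
}.

Record ModHom (X Y : ModOb) := {
  mhom : hom (mcar X) (mcar Y);
  mhom_comm : mact X >>> mhom = (idm R ⊗m mhom) >>> mact Y
}.
Arguments mhom {X Y} _.

Lemma ModHom_ext (X Y : ModOb) (f g : ModHom X Y) : mhom f = mhom g -> f = g.
Proof.
  destruct f as [f pf], g as [g pg]; simpl; intros ->.
  f_equal; apply proof_irrelevance.
Qed.

Lemma ModHom_id_comm (X : ModOb) : mact X >>> idm (mcar X) = (idm R ⊗m idm (mcar X)) >>> mact X.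
Proof. rewrite (tens_id _ M), comp_id_l, comp_id_r; reflexivity. Qed.

Definition ModHom_id (X : ModOb) : ModHom X X := Build_ModHom X X (idm _) (ModHom_id_comm X).

Lemma ModHom_comp_comm (X Y Z : ModOb) (f : ModHom X Y) (g : ModHom Y Z) :
  mact X >>> (mhom f >>> mhom g) = (idm R ⊗m (mhom f >>> mhom g)) >>> mact Z.
Proof.
  rewrite <- comp_assoc, (mhom_comm _ _ f), comp_assoc, (mhom_comm _ _ g), <- comp_assoc.
  rewrite <- (tens_comp _ M), comp_id_l; reflexivity.
Qed.

Definition ModHom_comp (X Y Z : ModOb) (f : ModHom X Y) (g : ModHom Y Z) : ModHom X Z :=
  Build_ModHom X Z (mhom f >>> mhom g) (ModHom_comp_comm X Y Z f g).

Definition MODcat : Category.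
Proof.
  refine (@Build_Category ModOb ModHom ModHom_id ModHom_comp _ _ _);
    intros; apply ModHom_ext; simpl;
    [apply comp_id_l | apply comp_id_r | apply comp_assoc].
Defined.
End ModCat.

Arguments mcar {C M R mult un} _.
Arguments mact {C M R mult un} _.
Arguments mhom {C M R mult un X Y} _.

Definition MOD {C : Category} {M : MonoidalStr C} {S : SymmetryStr M}
  (L : ModalityStr S) (Ad : AdditiveStr M) (A : C) : Category :=
  MODcat M (bang L A) (nablaA L Ad A) (uA L Ad A).

Definition IsLiftedSymMonoidal {C : Category} {M : MonoidalStr C} {S : SymmetryStr M}
  (L : ModalityStr S) (Ad : AdditiveStr M) (A : C)
  (M' : MonoidalStr (MOD L Ad A)) (S' : SymmetryStr M') : Prop :=
  let P := fun O : C => hom (tens M (bang L A) O) O in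
  (forall X Y : MOD L Ad A,
      existT P (mcar (tens M' X Y)) (mact (tens M' X Y))
      = existT P (tens M (mcar X) (mcar Y))
               (nA L A (mcar X) (mcar Y) >>> tensm M (mact X) (mact Y)))
  /\ existT P (mcar (munit M')) (mact (munit M'))
     = existT P (munit M) (nKA L A)
  /\ (forall (X X' Y Y' : MOD L Ad A) (f : hom X X') (g : hom Y Y'),
        hom_heq (mhom (tensm M' f g)) (tensm M (mhom f) (mhom g)))
  /\ (forall X Y Z : MOD L Ad A,
        hom_heq (mhom (assoc M' X Y Z)) (assoc M (mcar X) (mcar Y) (mcar Z)))
  /\ (forall X : MOD L Ad A, hom_heq (mhom (lu M' X)) (lu M (mcar X)))
  /\ (forall X : MOD L Ad A, hom_heq (mhom (ru M' X)) (ru M (mcar X)))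
  /\ (forall X Y : MOD L Ad A,
        hom_heq (mhom (sym S' X Y)) (sym S (mcar X) (mcar Y))).

(* Main.v *)
(** In the category of coalgebras of the comonad [!], the tensor product is the cartesian product
    and [!A] is the cofree coalgebra on [A], so maps of coalgebras into [!A] form the abelian group
    of maps into [A].  This makes [!A] an abelian group object: a map of coalgebras into [!A] is
    determined by its composite with [eps], which reduces the bialgebra laws and the antipode law
    of [!(-1)] to computations with sums.  The antipode inverts the fusion operators; these give a
    natural isomorphism [T (Y ⊗ X) -> T Y ⊗ X] for every module [X], through which the adjunction
    [- ⊗ X ⊣ X ⊸ -] lifts to modules, and everything else lifts along [lam].

    Coherence is obtained by letting an object [t] act as the endofunctor [t ⊗ -], expanded into
    iterated tensor products of atoms nested to the right: associators and unitors then act as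
    identities, and symmetries as composites of [swp : A ⊗ (B ⊗ X) -> B ⊗ (A ⊗ X)]. *)
From Corelib Require Import ssreflect ssrfun.
Require Import Defs.

Set Bullet Behavior "None".

Arguments comp_assoc {_ _ _ _ _} _ _ _.
Arguments comp_id_l {_ _ _} _.
Arguments comp_id_r {_ _ _} _.
Arguments tens_id {_ _} _ _.
Arguments tens_comp {_ _ _ _ _ _ _ _} _ _ _ _.
Arguments assoc_nat {_ _ _ _ _ _ _ _} _ _ _.
Arguments lu_nat {_ _ _ _} _.
Arguments ru_nat {_ _ _ _} _.
Arguments assoc_iso1 {_} _ _ _ _.
Arguments assoc_iso2 {_} _ _ _ _.
Arguments lu_iso1 {_} _ _.
Arguments lu_iso2 {_} _ _.
Arguments ru_iso1 {_} _ _.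
Arguments ru_iso2 {_} _ _.
Arguments pentagon {_} _ _ _ _ _.
Arguments triangle {_} _ _ _.
Arguments sym_nat {_ _} _ {_ _ _ _} _ _.
Arguments sym_invol {_ _} _ _ _.
Arguments hexagon {_ _} _ _ _ _.

(** * Monoidal and symmetric monoidal identities *)

Section Monoidal.
Context {C : Category} (M : MonoidalStr C).
Local Notation "A ⊗ B" := (tens M A B) (at level 30, right associativity).
Local Notation "f ⊗m g" := (tensm M f g) (at level 30, right associativity).
Local Notation K := (munit M).

Lemma compA2 {A B D E : C} {f : hom A B} {g : hom B D} {h : hom A D} {k : hom D E} :
  f >>> g = h -> f >>> (g >>> k) = h >>> k.
Proof. by move=> <-; rewrite comp_assoc. Qed.

Lemma compA3 {A B D E F : C} {f : hom A B} {g : hom B D} {h : hom D E} {r : hom A E}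
  {k : hom E F} :
  f >>> (g >>> h) = r -> f >>> (g >>> (h >>> k)) = r >>> k.
Proof. by move=> <-; rewrite !comp_assoc. Qed.

Lemma compL3 {A B D E : C} {f : hom A B} {g : hom B D} {h : hom D E} {r : hom A E} :
  f >>> g >>> h = r -> f >>> (g >>> h) = r.
Proof. by move=> <-; rewrite comp_assoc. Qed.

Lemma compV {A B D : C} {f : hom A B} {g : hom B A} {k : hom A D} :
  f >>> g = idm A -> f >>> (g >>> k) = k.
Proof. by move=> e; rewrite -comp_assoc e comp_id_l. Qed.

Lemma iso_cancel_l {A B D : C} (f : hom A B) (f' : hom B A) (g h : hom B D) :
  f' >>> f = idm B -> f >>> g = f >>> h -> g = h.
Proof.
move=> ff' e; rewrite -(comp_id_l g) -(comp_id_l h) -ff' !comp_assoc.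
by rewrite e.
Qed.

Lemma iso_cancel_r {A B D : C} (f : hom B D) (f' : hom D B) (g h : hom A B) :
  f >>> f' = idm B -> g >>> f = h >>> f -> g = h.
Proof.
move=> ff' e; rewrite -(comp_id_r g) -(comp_id_r h) -ff' -!comp_assoc.
by rewrite e.
Qed.

Lemma tens_split {A A' B B' : C} (f : hom A A') (g : hom B B') :
  f ⊗m g = (idm A ⊗m g) >>> (f ⊗m idm B').
Proof. by rewrite -tens_comp comp_id_l comp_id_r. Qed.

Lemma tens_compl {A B D : C} (X : C) (f : hom A B) (g : hom B D) :
  (f >>> g) ⊗m idm X = (f ⊗m idm X) >>> (g ⊗m idm X).
Proof. by rewrite -tens_comp comp_id_l. Qed.

Lemma tens_compr {A B D : C} (X : C) (f : hom A B) (g : hom B D) :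
  idm X ⊗m (f >>> g) = (idm X ⊗m f) >>> (idm X ⊗m g).
Proof. by rewrite -tens_comp comp_id_l. Qed.

Lemma interchange {A A' B B' : C} (f : hom A A') (g : hom B B') :
  (f ⊗m idm B) >>> (idm A' ⊗m g) = (idm A ⊗m g) >>> (f ⊗m idm B').
Proof. by rewrite -!tens_comp !comp_id_l !comp_id_r. Qed.

(** The right unitor identifies whiskering by [K] with the identity functor, so this whiskering is
    faithful. *)
Lemma whisker_unit_inj_r {A B : C} (f g : hom A B) : f ⊗m idm K = g ⊗m idm K -> f = g.
Proof.
move=> e; apply: (iso_cancel_l _ _ _ _ (ru_iso2 M A)).
by rewrite -!ru_nat e.
Qed.

Lemma whisker_unit_inj_l {A B : C} (f g : hom A B) : idm K ⊗m f = idm K ⊗m g -> f = g.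
Proof.
move=> e; apply: (iso_cancel_l _ _ _ _ (lu_iso2 M A)).
by rewrite -!lu_nat e.
Qed.

(** Kelly's argument: after whiskering by [K], the pentagon on [K, K, A, B] connects the two sides,
    and the middle triangle removes the unit from each of them. *)
Lemma lu_tens A B : lu M A ⊗m idm B = assoc M K A B >>> lu M (A ⊗ B).
Proof.
apply: whisker_unit_inj_l.
have i1 : (assoc_inv M K (K ⊗ A) B >>> (assoc_inv M K K A ⊗m idm B))
  >>> ((assoc M K K A ⊗m idm B) >>> assoc M K (K ⊗ A) B) = idm _.
  rewrite comp_assoc (compA2 (esym (tens_compl _ _ _))).
  by rewrite assoc_iso2 tens_id comp_id_l assoc_iso2.
apply: (iso_cancel_l _ _ _ _ i1).
rewrite tens_compr -!comp_assoc pentagon !comp_assoc triangle.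
rewrite -assoc_nat -!comp_assoc -tens_compl triangle.
by rewrite -(tens_id A B) assoc_nat.
Qed.

Lemma assoc_inv_nat {A A' B B' D D'} (f : hom A A') (g : hom B B') (h : hom D D') :
  (f ⊗m (g ⊗m h)) >>> assoc_inv M A' B' D' = assoc_inv M A B D >>> ((f ⊗m g) ⊗m h).
Proof.
apply: (iso_cancel_l _ _ _ _ (assoc_iso2 M _ _ _)).
rewrite -!comp_assoc -assoc_nat assoc_iso1 comp_id_l !comp_assoc assoc_iso1.
by rewrite comp_id_r.
Qed.
Lemma lu_inv_nat {A B} (f : hom A B) : f >>> lu_inv M B = lu_inv M A >>> (idm K ⊗m f).
Proof.
apply: (iso_cancel_r _ _ _ _ (lu_iso1 M _)).
by rewrite !comp_assoc lu_nat (compV (lu_iso2 _ _)) lu_iso2 comp_id_r.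
Qed.

Context (S : SymmetryStr M).

(** This comes from the hexagon on [A, K, K]: whisker by [K], insert [sym S A K >>> sym S K A] under
    [K], and cancel the remaining symmetry by naturality and involutivity. *)
Lemma sym_unit A : sym S A K >>> lu M A = ru M A.
Proof.
apply: whisker_unit_inj_r.
have e := compL3 (esym (hexagon S A K K)).
rewrite tens_compl lu_tens -triangle -[RHS]comp_id_r.
rewrite -[X in _ >>> (_ >>> X)]comp_id_l.
rewrite -(tens_id K (A ⊗ K)) -(sym_invol S A K) tens_compr comp_assoc.
rewrite (compA3 e) !comp_assoc lu_nat (compA2 (esym (lu_tens _ _))).
by rewrite (compA2 (esym (sym_nat S _ _))) !comp_assoc sym_invol.
Qed.

(* Sealed by [Qed]: unification would otherwise unfold [swp] when rewriting with [comp_assoc]. *)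
Lemma swp_sealed : {s : forall A B X, hom (A ⊗ (B ⊗ X)) (B ⊗ (A ⊗ X)) |
  forall A B X, s A B X = assoc_inv M A B X >>> ((sym S A B ⊗m idm X) >>> assoc M B A X)}.
Proof. by eexists=> A B X. Qed.

Definition swp A B X := proj1_sig swp_sealed A B X.

Lemma swpE A B X :
  swp A B X = assoc_inv M A B X >>> ((sym S A B ⊗m idm X) >>> assoc M B A X).
Proof. exact: (proj2_sig swp_sealed). Qed.

Lemma swp_nat {A A' B B' X X'} (f : hom A A') (g : hom B B') (h : hom X X') :
  (f ⊗m (g ⊗m h)) >>> swp A' B' X' = swp A B X >>> (g ⊗m (f ⊗m h)).
Proof.
rewrite !swpE !comp_assoc -assoc_nat (compA2 (assoc_inv_nat _ _ _)) comp_assoc.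
by rewrite (compA2 (esym (tens_comp _ _ _ _))) sym_nat
  (compA2 (esym (tens_comp _ _ _ _))) comp_id_l comp_id_r.
Qed.

Lemma swp_invol A B X : swp A B X >>> swp B A X = idm _.
Proof.
rewrite !swpE !comp_assoc (compV (assoc_iso1 _ _ _ _)).
rewrite (compA2 (esym (tens_compl _ _ _))) sym_invol tens_id comp_id_l.
exact: assoc_iso2.
Qed.

(** The hexagon, whiskered by [X]. Three pentagons move the associators hidden in [swp] out of the
    way. *)
Lemma swp_tens_r A B D X :
  swp A (B ⊗ D) X >>> assoc M B D (A ⊗ X)
  = (idm A ⊗m assoc M B D X) >>> (swp A B (D ⊗ X) >>> (idm B ⊗m swp A D X)).
Proof.
rewrite !swpE !tens_compr.
have i1 : assoc_inv M A (B ⊗ D) X >>> assoc M A (B ⊗ D) X = idm _ by exact: assoc_iso2.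
apply: (iso_cancel_l _ _ _ _ i1).
rewrite !comp_assoc !(compV (assoc_iso1 _ _ _ _)).
have i2 : (assoc_inv M A B D ⊗m idm X) >>> (assoc M A B D ⊗m idm X) = idm _.
  by rewrite -tens_compl assoc_iso2 tens_id.
apply: (iso_cancel_l _ _ _ _ i2).
rewrite [in RHS](compA3 (compL3 (pentagon M _ _ _ _))) !comp_assoc (compV (assoc_iso1 _ _ _ _)).
rewrite -{1}(tens_id D X) (compA2 (esym (assoc_nat _ _ _))) comp_assoc.
rewrite -(compL3 (pentagon M B D A X)).
have p := esym (compL3 (pentagon M B A D X)).
rewrite (compA2 p) !comp_assoc.
rewrite [in RHS](compA2 (esym (tens_compr _ _ _))) assoc_iso1 tens_id comp_id_l.
have h := f_equal (fun f => f ⊗m idm X) (compL3 (hexagon S A B D)).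
rewrite !tens_compl in h.
rewrite (compA3 h) !comp_assoc.
by rewrite (compA2 (assoc_nat _ _ _)) !comp_assoc.
Qed.

Lemma swp_unit_r A X : swp A K X >>> lu M (A ⊗ X) = idm A ⊗m lu M X.
Proof.
rewrite !swpE !comp_assoc -lu_tens -tens_compl sym_unit -triangle.
by rewrite (compV (assoc_iso2 _ _ _ _)).
Qed.

Lemma assoc_swp A B X :
  assoc M A B X >>> swp A B X = (sym S A B ⊗m idm X) >>> assoc M B A X.
Proof. by rewrite !swpE (compV (assoc_iso1 _ _ _ _)). Qed.

(** The other hexagon: as [swp] is its own inverse, it is obtained by inverting [swp_tens_r]. *)
Lemma swp_tens_l A B D X :
  swp (A ⊗ B) D X >>> (idm D ⊗m assoc M A B X)
  = assoc M A B (D ⊗ X) >>> ((idm A ⊗m swp B D X) >>> swp A D (B ⊗ X)).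
Proof.
apply: (iso_cancel_l _ _ _ _ (swp_invol _ _ _)).
rewrite (compV (swp_invol _ _ _)) (compA2 (swp_tens_r _ _ _ _)) !comp_assoc.
rewrite (compA2 (esym (tens_compr _ _ _))) swp_invol tens_id comp_id_l.
by rewrite swp_invol comp_id_r.
Qed.

Lemma swp_unit_l A X : swp K A X >>> (idm A ⊗m lu M X) = lu M (A ⊗ X).
Proof. by rewrite -swp_unit_r (compV (swp_invol _ _ _)). Qed.

(** * Strictification: syntax of objects and morphisms, and its soundness *)

Inductive oexpr := Oat (A : C) | Ounit | Oten (t s : oexpr).

Fixpoint oden (t : oexpr) : C :=
  match t with Oat A => A | Ounit => K | Oten t s => oden t ⊗ oden s end.

(** Bracketings and units disappear by computation: [act (Oten (Oten t s) r) X] and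
    [act (Oten t (Oten s r)) X] are convertible. This is what lets [core] send associators and
    unitors to [idm]. *)
Fixpoint act (t : oexpr) (X : C) : C :=
  match t with Oat A => A ⊗ X | Ounit => X | Oten t s => act t (act s X) end.

Fixpoint actm (t : oexpr) {X Y : C} (h : hom X Y) : hom (act t X) (act t Y) :=
  match t with Oat A => idm A ⊗m h | Ounit => h | Oten t s => actm t (actm s h) end.

Fixpoint flat (t : oexpr) (X : C) : hom (oden t ⊗ X) (act t X) :=
  match t with
  | Oat A => idm _
  | Ounit => lu M X
  | Oten t s => assoc M _ _ X >>> ((idm _ ⊗m flat s X) >>> flat t (act s X))
  end.

Fixpoint unflat (t : oexpr) (X : C) : hom (act t X) (oden t ⊗ X) :=
  match t with
  | Oat A => idm _
  | Ounit => lu_inv M X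
  | Oten t s => unflat t (act s X) >>> ((idm _ ⊗m unflat s X) >>> assoc_inv M _ _ X)
  end.

Fixpoint swap_at (A : C) (s : oexpr) (X : C) : hom (A ⊗ act s X) (act s (A ⊗ X)) :=
  match s with
  | Oat B => swp A B X
  | Ounit => idm _
  | Oten s s' => swap_at A s (act s' X) >>> actm s (swap_at A s' X)
  end.

Fixpoint swap (t s : oexpr) (X : C) : hom (act t (act s X)) (act s (act t X)) :=
  match t with
  | Oat A => swap_at A s X
  | Ounit => idm _
  | Oten t t' => actm t (swap t' s X) >>> swap t s (act t' X)
  end.

(** The endpoints are expressions rather than objects of [C], so a generator such as a
    multiplication [B ⊗ B -> B] still has a flattened source. *)
Inductive mexpr : oexpr -> oexpr -> Type :=
| Mid t : mexpr t t
| Mcomp t s r : mexpr t s -> mexpr s r -> mexpr t r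
| Mten t s t' s' : mexpr t t' -> mexpr s s' -> mexpr (Oten t s) (Oten t' s')
| Massoc t s r : mexpr (Oten (Oten t s) r) (Oten t (Oten s r))
| Massoci t s r : mexpr (Oten t (Oten s r)) (Oten (Oten t s) r)
| Mlu t : mexpr (Oten Ounit t) t
| Mlui t : mexpr t (Oten Ounit t)
| Mru t : mexpr (Oten t Ounit) t
| Mrui t : mexpr t (Oten t Ounit)
| Msym t s : mexpr (Oten t s) (Oten s t)
| Mgen t s : hom (oden t) (oden s) -> mexpr t s.

Fixpoint mden {t s} (m : mexpr t s) : hom (oden t) (oden s) :=
  match m with
  | Mid t => idm (oden t)
  | Mcomp _ _ _ f g => mden f >>> mden g
  | Mten _ _ _ _ f g => mden f ⊗m mden g
  | Massoc t s r => assoc M (oden t) (oden s) (oden r)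
  | Massoci t s r => assoc_inv M (oden t) (oden s) (oden r)
  | Mlu t => lu M (oden t)
  | Mlui t => lu_inv M (oden t)
  | Mru t => ru M (oden t)
  | Mrui t => ru_inv M (oden t)
  | Msym t s => sym S (oden t) (oden s)
  | Mgen _ _ f => f
  end.

(** An arbitrary morphism has no strict form of its own, so it is whiskered and conjugated by the
    flattening isomorphisms. Afterwards only [gen_nat] and transported equations are needed about
    it. *)
Definition gen t s (f : hom (oden t) (oden s)) X : hom (act t X) (act s X) :=
  unflat t X >>> ((f ⊗m idm X) >>> flat s X).

Fixpoint core {t s} (m : mexpr t s) : forall X, hom (act t X) (act s X) :=
  match m with
  | Mid t => fun X => idm _
  | Mcomp _ _ _ f g => fun X => core f X >>> core g X
  | Mten t s t' s' f g => fun X => actm t (core g X) >>> core f (act s' X)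
  | Massoc t s r => fun X => idm _
  | Massoci t s r => fun X => idm _
  | Mlu t => fun X => idm _
  | Mlui t => fun X => idm _
  | Mru t => fun X => idm _
  | Mrui t => fun X => idm _
  | Msym t s => fun X => swap t s X
  | Mgen t s f => gen t s f
  end.

Lemma flat_nat t {X Y} (h : hom X Y) :
  (idm (oden t) ⊗m h) >>> flat t Y = flat t X >>> actm t h.
Proof.
elim: t X Y h => [A||t IH s IH'] X Y h /=.
- by rewrite comp_id_l comp_id_r.
- exact: lu_nat.
rewrite -tens_id (compA2 (assoc_nat _ _ _)) !comp_assoc -IH.
by rewrite !(compA2 (esym (tens_compr _ _ _))) IH'.
Qed.

Lemma flatK t X : flat t X >>> unflat t X = idm _.
Proof.
elim: t X => [A||t IH s IH'] X /=; [exact: comp_id_l|exact: lu_iso1|].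
rewrite !comp_assoc (compV (IH _)) (compA2 (esym (tens_compr _ _ _))) IH' tens_id comp_id_l.
exact: assoc_iso1.
Qed.

Lemma unflatK t X : unflat t X >>> flat t X = idm _.
Proof.
elim: t X => [A||t IH s IH'] X /=; [exact: comp_id_l|exact: lu_iso2|].
rewrite !comp_assoc (compV (assoc_iso2 _ _ _ _)) (compA2 (esym (tens_compr _ _ _))).
by rewrite IH' tens_id comp_id_l.
Qed.

Lemma gen_nat t s f {X Y} (h : hom X Y) : actm t h >>> gen t s f Y = gen t s f X >>> actm s h.
Proof.
apply: (iso_cancel_l _ _ _ _ (unflatK _ _)).
rewrite (compA2 (esym (flat_nat _ _))) /gen !comp_assoc !(compV (flatK _ _)).
by rewrite -flat_nat (compA2 (interchange _ _)) comp_assoc.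
Qed.

Lemma swp_flat_at A s X :
  swp A (oden s) X >>> flat s (A ⊗ X) = (idm A ⊗m flat s X) >>> swap_at A s X.
Proof.
elim: s X => [B||t IH s IH'] X /=.
- by rewrite tens_id comp_id_l comp_id_r.
- by rewrite comp_id_r swp_unit_r.
rewrite (compA2 (swp_tens_r _ _ _ _)) !comp_assoc (compA2 (esym (tens_compr _ _ _))).
rewrite IH' tens_compr !comp_assoc (compA2 (esym (swp_nat _ _ _))) !comp_assoc flat_nat.
by rewrite (compA2 (IH _)) !tens_compr !comp_assoc.
Qed.

(** Induction on [t], over the atomic case [swp_flat_at]: [swap] follows the two hexagons,
    [swp_tens_l] splitting [t] and [swp_tens_r] splitting [s]. *)
Lemma swp_flat t s X :
  swp (oden t) (oden s) X >>> ((idm _ ⊗m flat t X) >>> flat s (act t X))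
  = (idm _ ⊗m flat s X) >>> (flat t (act s X) >>> swap t s X).
Proof.
elim: t X => [A||t IH t' IH'] X /=.
- by rewrite tens_id !comp_id_l swp_flat_at.
- by rewrite comp_id_r (compA2 (swp_unit_l _ _)) lu_nat.
rewrite !tens_compr !comp_assoc (compA2 (swp_tens_l _ _ _ _)) !comp_assoc.
rewrite (compA2 (esym (swp_nat _ _ _))) !comp_assoc IH.
rewrite !(compA2 (esym (tens_compr _ _ _))) !comp_assoc IH' !tens_compr !comp_assoc.
rewrite (compA2 (flat_nat _ _)) -tens_id (compA2 (assoc_nat _ _ _)).
by rewrite !comp_assoc.
Qed.

(** [flat] is an isomorphism from the functor [oden t ⊗ -] to [act t], and it conjugates the
    whiskering of a morphism into its strict form. Each constructor uses its own coherence axiom: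
    the pentagon for associators, triangles for unitors, hexagons for symmetries. *)
Lemma core_sound {t s} (m : mexpr t s) X :
  (mden m ⊗m idm X) >>> flat s X = flat t X >>> core m X.
Proof.
elim: t s / m X => /=
  [t|t s r f IH g IH'|t s t' s' f IH g IH'|t s r|t s r|t|t|t|t|t s|t s f] X.
- by rewrite tens_id comp_id_l comp_id_r.
- by rewrite tens_compl comp_assoc IH' (compA2 (IH _)) comp_assoc.
- rewrite (compA2 (assoc_nat _ _ _)) !comp_assoc (compA2 (esym (tens_comp _ _ _ _))).
  rewrite comp_id_r IH' tens_split !comp_assoc IH tens_compr !comp_assoc.
  by rewrite (compA2 (flat_nat _ _)) comp_assoc.
- rewrite comp_id_r tens_compr !comp_assoc (compA3 (compL3 (pentagon _ _ _ _ _))).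
  rewrite tens_compr !comp_assoc (compA2 (esym (assoc_nat _ _ _))).
  by rewrite tens_id !comp_assoc.
(* Precomposing with the whiskered associator reduces the inverse to the previous case; the inverse
   unitors are treated alike. *)
- apply: (iso_cancel_l (assoc M _ _ _ ⊗m idm X) (assoc_inv M _ _ _ ⊗m idm X)).
    by rewrite -tens_compl assoc_iso2 tens_id.
  rewrite (compA2 (esym (tens_compl _ _ _))) assoc_iso1 tens_id comp_id_l comp_id_r.
  rewrite tens_compr !comp_assoc (compA3 (compL3 (pentagon _ _ _ _ _))).
  rewrite tens_compr !comp_assoc (compA2 (esym (assoc_nat _ _ _))).
  by rewrite tens_id !comp_assoc.
- by rewrite comp_id_r lu_tens lu_nat !comp_assoc.
- apply: (iso_cancel_l (lu M _ ⊗m idm X) (lu_inv M _ ⊗m idm X)).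
    by rewrite -tens_compl lu_iso2 tens_id.
  rewrite (compA2 (esym (tens_compl _ _ _))) lu_iso1 tens_id comp_id_l comp_id_r.
  by rewrite lu_tens lu_nat comp_assoc.
- by rewrite comp_id_r -(compA2 (triangle _ _ _)).
- apply: (iso_cancel_l (ru M _ ⊗m idm X) (ru_inv M _ ⊗m idm X)).
    by rewrite -tens_compl ru_iso2 tens_id.
  rewrite (compA2 (esym (tens_compl _ _ _))) ru_iso1 tens_id comp_id_l comp_id_r.
  by rewrite -(compA2 (triangle _ _ _)).
- by rewrite !comp_assoc -swp_flat (compA2 (assoc_swp _ _ _)) comp_assoc.
- by rewrite /gen (compV (flatK _ _)).
Qed.

(** At [X = K] whiskering is faithful and [flat] is invertible, so the strict form determines the
    morphism. *)
Theorem core_inj {t s} (m m' : mexpr t s) :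
  (forall X, core m X = core m' X) -> mden m = mden m'.
Proof.
move=> e; apply: whisker_unit_inj_r.
apply: (iso_cancel_r (flat s K) (unflat s K)); first exact: flatK.
by rewrite !core_sound e.
Qed.

(** The converse direction, by which known equations, such as bialgebra laws, are carried to strict
    form and used for rewriting there. *)
Lemma core_eq {t s} (m m' : mexpr t s) X : mden m = mden m' -> core m X = core m' X.
Proof.
move=> e; apply: (iso_cancel_l _ _ _ _ (unflatK _ _)).
by rewrite -!core_sound e.
Qed.
End Monoidal.

Arguments Oat {C}.
Arguments Ounit {C}.
Arguments Oten {C}.

(* The standard [rewrite ->], unlike the ssreflect one, does not unfold definitions. *)
Ltac ca := repeat rewrite -> comp_assoc.

(** Matching is syntactic, and whatever is not visibly a tensor or the unit becomes an atom. Hence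
    [TA], [muA] and the like are unfolded before [strictify] is called. *)
Ltac reify_o M T :=
  lazymatch T with
  | tens M ?a ?b => let x := reify_o M a in let y := reify_o M b in constr:(Oten x y)
  | @munit ?C M => constr:(@Ounit C)
  | ?a => constr:(Oat a)
  end.

Ltac reify_m M S f :=
  lazymatch f with
  | comp ?f ?g =>
      let x := reify_m M S f in let y := reify_m M S g in constr:(Mcomp M _ _ _ x y)
  | tensm M ?f ?g =>
      let x := reify_m M S f in let y := reify_m M S g in constr:(Mten M _ _ _ _ x y)
  | idm ?a => let x := reify_o M a in constr:(Mid M x)
  | assoc M ?a ?b ?d =>
      let x := reify_o M a in let y := reify_o M b in let z := reify_o M d in
      constr:(Massoc M x y z)
  | assoc_inv M ?a ?b ?d =>
      let x := reify_o M a in let y := reify_o M b in let z := reify_o M d in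
      constr:(Massoci M x y z)
  | lu M ?a => let x := reify_o M a in constr:(Mlu M x)
  | lu_inv M ?a => let x := reify_o M a in constr:(Mlui M x)
  | ru M ?a => let x := reify_o M a in constr:(Mru M x)
  | ru_inv M ?a => let x := reify_o M a in constr:(Mrui M x)
  | sym S ?a ?b => let x := reify_o M a in let y := reify_o M b in constr:(Msym M x y)
  | ?f =>
      lazymatch type of f with
      | hom ?a ?b => let x := reify_o M a in let y := reify_o M b in constr:(Mgen M x y f)
      end
  end.

Ltac strict_simpl :=
  cbn [core swap swap_at actm act oden];
  repeat (rewrite tens_id || rewrite comp_id_l || rewrite comp_id_r);
  repeat rewrite -> tens_compr; ca.

(* Replaces an equation of morphisms by the equation of their strictifications, in which the
   associators and unitors have disappeared. *)
Ltac strictify M S :=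
  lazymatch goal with
  | |- ?f = ?g =>
      let m := reify_m M S f in
      let m' := reify_m M S g in
      refine (core_inj M S m m' _); let Z := fresh "Z" in intro Z; strict_simpl
  end.

Ltac strictify_in M S H X :=
  lazymatch type of H with
  | ?f = ?g =>
      let m := reify_m M S f in
      let m' := reify_m M S g in
      let e := fresh in
      have e := core_eq M S m m' X H;
      clear H; rename e into H; move: H; strict_simpl; move=> H
  end.

(** * Coherence of the interchange [tau] *)

Section Tau.
Context {C : Category} {M : MonoidalStr C} (S : SymmetryStr M).
Local Notation "A ⊗ B" := (tens M A B) (at level 30, right associativity).
Local Notation "f ⊗m g" := (tensm M f g) (at level 30, right associativity).
Local Notation K := (munit M).

Lemma tau_nat {A B D E A' B' D' E' : C}
  (f : hom A A') (g : hom B B') (h : hom D D') (k : hom E E') :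
  ((f ⊗m g) ⊗m (h ⊗m k)) >>> tau S A' B' D' E'
  = tau S A B D E >>> ((f ⊗m h) ⊗m (g ⊗m k)).
Proof.
rewrite /tau !comp_assoc (compA2 (assoc_nat _ _ _)) comp_assoc -(assoc_inv_nat M).
rewrite !(compA2 (esym (tens_comp _ _ _ _))) !comp_assoc !comp_id_l !comp_id_r -assoc_nat.
rewrite (compA2 (assoc_inv_nat M _ _ _)) !comp_assoc !(compA2 (esym (tens_comp _ _ _ _))).
by rewrite sym_nat comp_id_l comp_id_r.
Qed.

Lemma tau_assoc A B D E F G :
  assoc_inv M (A ⊗ B) (D ⊗ E) (F ⊗ G)
    >>> ((tau S A B D E ⊗m idm (F ⊗ G)) >>> tau S (A ⊗ D) (B ⊗ E) F G)
  = (idm (A ⊗ B) ⊗m tau S D E F G)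
    >>> (tau S A B (D ⊗ F) (E ⊗ G) >>> (assoc_inv M A D F ⊗m assoc_inv M B E G)).
Proof.
rewrite /tau; strictify M S.
(* Both strict sides perform the same crossings in different orders. The crossings of [B] with [D]
   and of [E] with [F] act on disjoint strands, so naturality of [swp] commutes them. *)
have e := swp_nat M S (idm B) (idm D) (swp M S E F (G ⊗ Z)).
by rewrite !(compA2 (esym (tens_compr _ _ _ _))) e.
Qed.

Lemma tau_assoc_inv A B D E F G :
  (assoc M A B D ⊗m assoc M E F G) >>> (tau S A (B ⊗ D) E (F ⊗ G)
    >>> (idm (A ⊗ E) ⊗m tau S B D F G))
  = tau S (A ⊗ B) D (E ⊗ F) G >>> ((tau S A B E F ⊗m idm (D ⊗ G)) >>> assoc M _ _ _).
Proof.
rewrite /tau; strictify M S.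
have e := swp_nat M S (idm B) (idm E) (swp M S D F (G ⊗ Z)).
by congr (_ >>> _); rewrite -!tens_compr e.
Qed.

Lemma tau_sym A B D E :
  (sym S A B ⊗m sym S D E) >>> tau S B A E D = tau S A B D E >>> sym S (A ⊗ D) (B ⊗ E).
Proof.
rewrite /tau; strictify M S.
by rewrite (compA2 (esym (tens_compr _ _ _ _))) swp_invol tens_id comp_id_l.
Qed.
End Tau.

Arguments bang_id {_ _ _} _ _.
Arguments bang_comp {_ _ _} _ {_ _ _} _ _.
Arguments delta_nat {_ _ _} _ {_ _} _.
Arguments eps_nat {_ _ _} _ {_ _} _.
Arguments mm_nat {_ _ _} _ {_ _ _ _} _ _.
Arguments mm_assoc {_ _ _} _ _ _ _.
Arguments mm_sym {_ _ _} _ _ _.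
Arguments comonad_counit1 {_ _ _} _ _.
Arguments comonad_counit2 {_ _ _} _ _.
Arguments cdup_nat {_ _ _} _ {_ _} _.
Arguments cerase_nat {_ _ _} _ {_ _} _.
Arguments mm_lunit {_ _ _} _ _.
Arguments mm_runit {_ _ _} _ _.
Arguments eps_monoidal {_ _ _} _ _ _.
Arguments eps_monoidalK {_ _ _} _.
Arguments delta_monoidal {_ _ _} _ _ _.
Arguments delta_monoidalK {_ _ _} _.
Arguments cdup_monoidal {_ _ _} _ _ _.
Arguments cdup_monoidalK {_ _ _} _.
Arguments cerase_monoidal {_ _ _} _ _ _.
Arguments cerase_monoidalK {_ _ _} _.
Arguments cerase_coalg {_ _ _} _ _.

Ltac tens_merge :=
  ca; rewrite ?(compA2 (esym (tens_comp _ _ _ _))) -?tens_comp ?comp_id_l ?comp_id_r; ca.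

(** * Coalgebras of the comonad and their tensor product *)

Section Coalgebras.
Context {C : Category} {M : MonoidalStr C} {S : SymmetryStr M} (L : ModalityStr S).
Local Notation "A ⊗ B" := (tens M A B) (at level 30, right associativity).
Local Notation "f ⊗m g" := (tensm M f g) (at level 30, right associativity).
Local Notation K := (munit M).
Local Notation "! A" := (bang L A) (at level 20).
Local Notation "!m f" := (bangm L f) (at level 20).

Lemma mm_nat_l {A A' : C} (B : C) (f : hom A A') :
  (!m f ⊗m idm (! B)) >>> mm L A' B = mm L A B >>> !m (f ⊗m idm B).
Proof. by rewrite -mm_nat bang_id. Qed.

Lemma mm_nat_r (A : C) {B B' : C} (g : hom B B') :
  (idm (! A) ⊗m !m g) >>> mm L A B' = mm L A B >>> !m (idm A ⊗m g).
Proof. by rewrite -mm_nat bang_id. Qed.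

Lemma mm_assoc_inv A B D :
  (idm (! A) ⊗m mm L B D) >>> (mm L A (B ⊗ D) >>> !m (assoc_inv M A B D))
  = assoc_inv M (! A) (! B) (! D) >>> ((mm L A B ⊗m idm (! D)) >>> mm L (A ⊗ B) D).
Proof.
apply: (iso_cancel_l _ _ _ _ (assoc_iso2 _ _ _ _)).
rewrite (compV (assoc_iso1 _ _ _ _)) (compA3 (compL3 (esym (mm_assoc L _ _ _)))) !comp_assoc.
by rewrite -bang_comp assoc_iso1 bang_id comp_id_r.
Qed.

(** [tau] is a composite of associators and a symmetry, through which [mm] passes by [mm_assoc] and
    [mm_sym]. [R1] and [R1i] treat its first and last factors. *)
Lemma mm_tau A B D E :
  (mm L A B ⊗m mm L D E) >>> (mm L (A ⊗ B) (D ⊗ E) >>> !m (tau S A B D E))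
  = tau S (! A) (! B) (! D) (! E) >>> ((mm L A D ⊗m mm L B E) >>> mm L (A ⊗ D) (B ⊗ E)).
Proof.
have R1 X Y Z W : (mm L X Y ⊗m mm L Z W) >>> (mm L (X ⊗ Y) (Z ⊗ W) >>> !m (assoc M X Y (Z ⊗ W)))
  = assoc M (! X) (! Y) (! Z ⊗ ! W) >>>
    ((idm (! X) ⊗m ((idm (! Y) ⊗m mm L Z W) >>> mm L Y (Z ⊗ W))) >>> mm L X (Y ⊗ (Z ⊗ W))).
  rewrite tens_split !comp_assoc (compL3 (mm_assoc L _ _ _)) tens_compr !comp_assoc.
  by rewrite -tens_id (compA2 (assoc_nat _ _ _)) !comp_assoc.
have R1i X Y Z W : (idm (! X) ⊗m ((idm (! Y) ⊗m mm L Z W) >>> mm L Y (Z ⊗ W)))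
     >>> (mm L X (Y ⊗ (Z ⊗ W)) >>> !m (assoc_inv M X Y (Z ⊗ W)))
   = assoc_inv M (! X) (! Y) (! Z ⊗ ! W) >>> ((mm L X Y ⊗m mm L Z W) >>> mm L (X ⊗ Y) (Z ⊗ W)).
  apply: (iso_cancel_l _ _ _ _ (assoc_iso2 _ _ _ _)).
  rewrite (compV (assoc_iso1 _ _ _ _)) (compA3 (esym (R1 _ _ _ _))) !comp_assoc.
  by rewrite -bang_comp assoc_iso1 bang_id comp_id_r.
rewrite /tau !bang_comp !comp_assoc (compA3 (R1 _ _ _ _)) !comp_assoc -R1i.
do 3! rewrite (compA2 (esym (mm_nat_r _ _))) !comp_assoc.
rewrite !(compA2 (esym (tens_compr _ _ _ _))) !comp_assoc.
rewrite (compA3 (mm_assoc_inv _ _ _)) !comp_assoc (compA2 (esym (mm_nat_l _ _))).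
rewrite comp_assoc (compA2 (esym (tens_compl _ _ _ _))) -mm_sym tens_compl comp_assoc.
by rewrite (compL3 (mm_assoc L _ _ _)) !comp_assoc.
Qed.

Definition coalg_mor {X Y : C} (x : hom X (! X)) (y : hom Y (! Y)) (f : hom X Y) : Prop :=
  f >>> y = x >>> !m f.

Definition coalg_tens {X Y : C} (x : hom X (! X)) (y : hom Y (! Y)) : hom (X ⊗ Y) (! (X ⊗ Y)) :=
  (x ⊗m y) >>> mm L X Y.

(** Such an [f] is recovered from its composite with the counit:
    [f = f >>> δ >>> !ε = x >>> !(f >>> ε)]. *)
Lemma cofree_ext {X A : C} {x : hom X (! X)} {f g : hom X (! A)} :
  coalg_mor x (delta L A) f -> coalg_mor x (delta L A) g ->
  f >>> eps L A = g >>> eps L A -> f = g.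
Proof.
move=> cf cg e; rewrite -(comp_id_r f) -(comp_id_r g) -comonad_counit2 -!comp_assoc.
by rewrite cf cg !comp_assoc -!bang_comp e.
Qed.

Lemma coalg_mor_id {X} (x : hom X (! X)) : coalg_mor x x (idm X).
Proof. by rewrite /coalg_mor bang_id comp_id_l comp_id_r. Qed.

Lemma coalg_mor_comp {X Y Z} {x : hom X (! X)} {y : hom Y (! Y)} {z : hom Z (! Z)}
  {f : hom X Y} {g : hom Y Z} :
  coalg_mor x y f -> coalg_mor y z g -> coalg_mor x z (f >>> g).
Proof. by rewrite /coalg_mor comp_assoc bang_comp => cf ->; rewrite -!comp_assoc cf. Qed.

Lemma coalg_mor_tens {X Y X' Y'} {x : hom X (! X)} {y : hom Y (! Y)}
  {x' : hom X' (! X')} {y' : hom Y' (! Y')} {f : hom X X'} {g : hom Y Y'} :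
  coalg_mor x x' f -> coalg_mor y y' g ->
  coalg_mor (coalg_tens x y) (coalg_tens x' y') (f ⊗m g).
Proof.
rewrite /coalg_mor /coalg_tens => cf cg.
by rewrite comp_assoc -mm_nat; tens_merge; rewrite cf cg.
Qed.

Lemma coalg_mor_assoc {X Y Z} {x : hom X (! X)} {y : hom Y (! Y)} {z : hom Z (! Z)} :
  coalg_mor (coalg_tens (coalg_tens x y) z) (coalg_tens x (coalg_tens y z)) (assoc M X Y Z).
Proof.
rewrite /coalg_mor /coalg_tens -[X in _ = _ ⊗m X >>> _ >>> _]comp_id_r tens_comp !comp_assoc.
rewrite (compL3 (mm_assoc L _ _ _)) !comp_assoc (compA2 (assoc_nat _ _ _)) comp_assoc.
by tens_merge.
Qed.

Lemma coalg_mor_lu {X} {x : hom X (! X)} : coalg_mor (coalg_tens (mK L) x) x (lu M X).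
Proof.
rewrite /coalg_mor /coalg_tens tens_split !comp_assoc.
by rewrite (compL3 (mm_lunit L _)) lu_nat.
Qed.

Lemma coalg_mor_ru {X} {x : hom X (! X)} : coalg_mor (coalg_tens x (mK L)) x (ru M X).
Proof.
rewrite /coalg_mor /coalg_tens tens_split -interchange !comp_assoc.
by rewrite (compL3 (mm_runit L _)) ru_nat.
Qed.

Lemma coalg_mor_bang {A B} (f : hom A B) : coalg_mor (delta L A) (delta L B) (!m f).
Proof. exact: delta_nat. Qed.

Lemma coalg_mor_cdup A : coalg_mor (delta L A) (coalg_tens (delta L A) (delta L A)) (cdup L A).
Proof. by rewrite /coalg_mor /coalg_tens -comp_assoc cdup_coalg. Qed.

Lemma coalg_mor_cerase A : coalg_mor (delta L A) (mK L) (cerase L A).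
Proof. exact: cerase_coalg. Qed.
End Coalgebras.

(** * The Hopf algebra structure of [!A] *)

Section Bialgebra.
Context {C : Category} {M : MonoidalStr C} {S : SymmetryStr M} (L : ModalityStr S)
        (Ad : AdditiveStr M) (A : C).
Local Notation "A ⊗ B" := (tens M A B) (at level 30, right associativity).
Local Notation "f ⊗m g" := (tensm M f g) (at level 30, right associativity).
Local Notation K := (munit M).
Local Notation "! A" := (bang L A) (at level 20).
Local Notation "!m f" := (bangm L f) (at level 20).
Local Notation B := (bang L A).
Local Notation "'δ'" := (delta L A).
Local Notation "'ε'" := (eps L A).
Local Notation "'Δ'" := (cdup L A).
Local Notation "'e'" := (cerase L A).
Local Notation "'∇'" := (nablaA L Ad A).
Local Notation "'υ'" := (uA L Ad A).
Local Notation "f + g" := (hadd Ad f g).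

Definition antipode : hom B B := !m (hneg Ad (idm A)).
Local Notation "'σ'" := antipode.

(** [∇] is the structure map of the coalgebra [!A ⊗ !A] followed by [!] of a map into [A]. This is
    the general form of the coalgebra map into a cofree coalgebra induced by a map into [A]. *)
Lemma nabla_coalg : coalg_mor L (coalg_tens L δ δ) δ ∇.
Proof.
rewrite /coalg_mor /coalg_tens /nablaA !comp_assoc delta_nat.
rewrite (compA2 (delta_monoidal L _ _)) !comp_assoc -!bang_comp.
rewrite !bang_comp (compA2 (esym (mm_nat L _ _))) !comp_assoc; tens_merge.
by rewrite -comonad_coassoc.
Qed.

Lemma u_coalg : coalg_mor L (mK L) δ υ.
Proof.
rewrite /coalg_mor /uA !comp_assoc delta_nat bang_comp.
by rewrite (compA2 (delta_monoidalK L)) !comp_assoc.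
Qed.

(** Under [ε], multiplication becomes the sum of the two projections; this and [u_eps] are how the
    additive structure enters the proofs of the algebra laws. *)
Lemma nabla_eps : ∇ >>> ε = ((ε ⊗m e) >>> ru M A) + ((e ⊗m ε) >>> lu M A).
Proof.
rewrite /nablaA !comp_assoc eps_nat (compA2 (eps_monoidal L _ _)).
by rewrite (compA2 (esym (tens_comp _ _ _ _))) !comonad_counit1 tens_id comp_id_l.
Qed.

Lemma u_eps : υ >>> ε = hzero Ad K A.
Proof. by rewrite /uA comp_assoc eps_nat (compV (eps_monoidalK L)). Qed.

Lemma nabla_e : ∇ >>> e = (e ⊗m e) >>> lu M K.
Proof.
rewrite /nablaA !comp_assoc cerase_nat cerase_monoidal.
by tens_merge; rewrite !delta_cerase.
Qed.

Lemma u_e : υ >>> e = idm K.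
Proof. by rewrite /uA comp_assoc cerase_nat cerase_monoidalK. Qed.

(** Every factor of [∇] respects duplication: [δ] by [delta_cdup], [mm] by [cdup_monoidal], and [!]
    of a map by naturality. *)
Lemma nabla_cdup : ∇ >>> Δ = (Δ ⊗m Δ) >>> (tau S B B B B >>> (∇ ⊗m ∇)).
Proof.
rewrite /nablaA; ca; rewrite cdup_nat (compA2 (cdup_monoidal L _ _)) !tens_comp; ca.
rewrite (compA2 (esym (tau_nat S _ _ _ _))); ca.
by rewrite !(compA2 (esym (tens_comp _ _ _ _))) !delta_cdup.
Qed.

Lemma u_cdup : υ >>> Δ = lu_inv M K >>> (υ ⊗m υ).
Proof.
rewrite /uA comp_assoc cdup_nat (compA2 (cdup_monoidalK L)) !comp_assoc.
by tens_merge.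
Qed.

Lemma nabla_assoc : (∇ ⊗m idm B) >>> ∇ = assoc M B B B >>> ((idm B ⊗m ∇) >>> ∇).
Proof.
apply: (cofree_ext L (x := coalg_tens L (coalg_tens L δ δ) δ)).
- apply: (coalg_mor_comp L _ nabla_coalg).
  exact: (coalg_mor_tens L nabla_coalg (coalg_mor_id L _)).
- apply: (coalg_mor_comp L (coalg_mor_assoc L)).
  apply: (coalg_mor_comp L _ nabla_coalg).
  exact: (coalg_mor_tens L (coalg_mor_id L _) nabla_coalg).
(* Under [ε] both sides become the sum of the three projections to [A], bracketed differently. *)
ca; rewrite nabla_eps !comp_addr; tens_merge.
rewrite nabla_eps nabla_e tens_addl tens_addr comp_addl comp_addl comp_addr.
rewrite hadd_assoc; congr (_ + (_ + _)); strictify M S; done.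
Qed.

Lemma nabla_unit_l : (υ ⊗m idm B) >>> ∇ = lu M B.
Proof.
apply: (cofree_ext L (x := coalg_tens L (mK L) δ)).
- apply: (coalg_mor_comp L _ nabla_coalg).
  exact: (coalg_mor_tens L u_coalg (coalg_mor_id L _)).
- exact: coalg_mor_lu.
ca; rewrite nabla_eps !comp_addr; tens_merge.
by rewrite u_eps u_e tens_0l comp_0l hadd_0 lu_nat.
Qed.

Lemma nabla_unit_r : (idm B ⊗m υ) >>> ∇ = ru M B.
Proof.
apply: (cofree_ext L (x := coalg_tens L δ (mK L))).
- apply: (coalg_mor_comp L _ nabla_coalg).
  exact: (coalg_mor_tens L (coalg_mor_id L _) u_coalg).
- exact: coalg_mor_ru.
ca; rewrite nabla_eps !comp_addr; tens_merge.
by rewrite u_eps u_e tens_0r comp_0l hadd_comm hadd_0 ru_nat.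
Qed.

Lemma cdup_e_r {X} (f : hom B X) : Δ >>> ((f ⊗m e) >>> ru M X) = f.
Proof.
rewrite tens_split comp_assoc ru_nat -!comp_assoc cdup_rcounit.
exact: comp_id_l.
Qed.

Lemma cdup_e_l {X} (f : hom B X) : Δ >>> ((e ⊗m f) >>> lu M X) = f.
Proof.
rewrite tens_split -interchange comp_assoc lu_nat -!comp_assoc cdup_lcounit.
exact: comp_id_l.
Qed.

(** Under [ε], and after [cdup_e_r] and [cdup_e_l] absorb the erasures, the left side is [ε] plus
    its negative, and the right side is zero because [u_eps] is. *)
Lemma antipode_r : Δ >>> ((idm B ⊗m σ) >>> ∇) = e >>> υ.
Proof.
apply: (cofree_ext L (x := δ)).
- apply: (coalg_mor_comp L (coalg_mor_cdup L A)).
  apply: (coalg_mor_comp L _ nabla_coalg).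
  exact: (coalg_mor_tens L (coalg_mor_id L _) (coalg_mor_bang L _)).
- exact: (coalg_mor_comp L (coalg_mor_cerase L A) u_coalg).
ca; rewrite nabla_eps u_eps comp_0r !comp_addr; tens_merge.
rewrite /antipode cerase_nat eps_nat cdup_e_r cdup_e_l.
by rewrite -{1}(comp_id_r ε) -comp_addr hadd_comm hadd_neg comp_0r.
Qed.

Lemma antipode_l : Δ >>> ((σ ⊗m idm B) >>> ∇) = e >>> υ.
Proof.
apply: (cofree_ext L (x := δ)).
- apply: (coalg_mor_comp L (coalg_mor_cdup L A)).
  apply: (coalg_mor_comp L _ nabla_coalg).
  exact: (coalg_mor_tens L (coalg_mor_bang L _) (coalg_mor_id L _)).
- exact: (coalg_mor_comp L (coalg_mor_cerase L A) u_coalg).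
ca; rewrite nabla_eps u_eps comp_0r !comp_addr; tens_merge.
rewrite /antipode cerase_nat eps_nat cdup_e_r cdup_e_l.
by rewrite -{2}(comp_id_r ε) -comp_addr hadd_neg comp_0r.
Qed.
End Bialgebra.

(** * The monad [!A ⊗ -] and its distribution over the modality *)

Section BangMonadIsMELL.
Context {C : Category} {M : MonoidalStr C} {S : SymmetryStr M} (L : ModalityStr S)
        (Ad : AdditiveStr M) (A : C).
Local Notation "A ⊗ B" := (tens M A B) (at level 30, right associativity).
Local Notation "f ⊗m g" := (tensm M f g) (at level 30, right associativity).
Local Notation K := (munit M).
Local Notation "! A" := (bang L A) (at level 20).
Local Notation "!m f" := (bangm L f) (at level 20).
Local Notation B := (bang L A).
Local Notation "'δ'" := (delta L A).
Local Notation "'Δ'" := (cdup L A).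
Local Notation "'e'" := (cerase L A).
Local Notation "'∇'" := (nablaA L Ad A).
Local Notation "'υ'" := (uA L Ad A).
Local Notation "'σ'" := (antipode L Ad A).

Local Notation D := (gen M (Oat B) (Oten (Oat B) (Oat B)) Δ).
Local Notation N := (gen M (Oten (Oat B) (Oat B)) (Oat B) ∇).

Lemma strict_cdup_nat {X Y} (h : hom X Y) :
  (idm B ⊗m h) >>> D Y = D X >>> (idm B ⊗m (idm B ⊗m h)).
Proof. exact: (gen_nat M (Oat B) (Oten (Oat B) (Oat B))). Qed.

Lemma strict_endo_nat (φ : hom B B) {X Y} (h : hom X Y) :
  (idm B ⊗m h) >>> gen M (Oat B) (Oat B) φ Y = gen M (Oat B) (Oat B) φ X >>> (idm B ⊗m h).
Proof. exact: (gen_nat M (Oat B) (Oat B)). Qed.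

Lemma strict_cdup_coassoc X : D X >>> D (B ⊗ X) = D X >>> (idm B ⊗m D X).
Proof. by have h := cdup_coassoc _ L A; strictify_in M S h X. Qed.

Lemma strict_nabla_assoc X : (idm B ⊗m N X) >>> N X = N (B ⊗ X) >>> N X.
Proof. by have h := nabla_assoc L Ad A; strictify_in M S h X. Qed.

(** Moving two copies of [B] past [Y] and then multiplying agrees with multiplying first, by
    naturality of the symmetry in [∇]. *)
Lemma strict_nabla_swp Y X :
  (idm B ⊗m swp M S B Y X) >>> (swp M S B Y (B ⊗ X) >>> (idm Y ⊗m N X))
  = N (Y ⊗ X) >>> swp M S B Y X.
Proof.
by have h := sym_nat S ∇ (idm Y); strictify_in M S h X; rewrite h.
Qed.

(* [h ⊗ (x ⊗ (g ⊗ y)) ↦ (h₁ ⊗ x) ⊗ (φ(h₂) g ⊗ y)]: the left fusion operator is [fusion (idm _)]. *)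
Definition fusion (φ : hom B B) (X Y : C) : hom (B ⊗ (X ⊗ (B ⊗ Y))) ((B ⊗ X) ⊗ (B ⊗ Y)) :=
  (Δ ⊗m idm _) >>> (((idm B ⊗m φ) ⊗m idm _)
    >>> (tau S B B X (B ⊗ Y) >>> (idm _ ⊗m (assoc_inv M B B Y >>> (∇ ⊗m idm Y))))).

(** Composition becomes convolution, in reversed order: the composite sends [h ⊗ (x ⊗ (g ⊗ y))] to
    [(h₁ ⊗ x) ⊗ (ψ(h₂) φ(h₃) g ⊗ y)]. The antipode, being the convolution inverse of the identity,
    will therefore invert the fusion operator. *)
Lemma fusion_comp φ ψ X Y :
  fusion φ X Y >>> (assoc M _ _ _ >>> fusion ψ X Y)
  = fusion (Δ >>> ((ψ ⊗m φ) >>> ∇)) X Y.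
Proof.
rewrite /fusion /tau; strictify M S.
do 3! (rewrite (compA2 (strict_cdup_nat _)); ca).
rewrite (compA2 (strict_cdup_coassoc _)); ca; congr (_ >>> _).
rewrite -!tens_compr; congr (_ ⊗m _); congr (_ >>> _).
do 2! (rewrite (compA2 (strict_endo_nat _ _)); ca).
do 2! congr (_ >>> _).
(* The two crossings past [X] are brought together, so that associativity of [∇] and
   [strict_nabla_swp] merge them into one. *)
rewrite (compA2 (swp_nat M S _ _ _)); ca.
rewrite -tens_compr strict_nabla_assoc tens_compr.
by rewrite (compA3 (strict_nabla_swp _ _)); ca.
Qed.

(** [e >>> υ] is the unit for convolution: the inserted [υ] slides past [X] and is absorbed by [∇],
    while [e] is absorbed by [Δ]. *)
Lemma fusion_unit X Y : fusion (e >>> υ) X Y >>> assoc M _ _ _ = idm _.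
Proof.
rewrite /fusion /tau; strictify M S.
have hs := sym_nat S υ (idm X); strictify_in M S hs (B ⊗ (Y ⊗ Z)).
rewrite -!tens_compr (compA2 hs) -tens_compr.
have hu := nabla_unit_l L Ad A; strictify_in M S hu (Y ⊗ Z).
rewrite -!tens_compr hu tens_id !comp_id_r.
by have hc := cdup_rcounit _ L A; strictify_in M S hc (X ⊗ (B ⊗ (Y ⊗ Z))).
Qed.

Lemma is_iso_comp {X Y Z : C} (f : hom X Y) (g : hom Y Z) :
  is_iso f -> is_iso g -> is_iso (f >>> g).
Proof.
move=> [f' [ff' f'f]] [g' [gg' g'g]]; exists (g' >>> f').
by rewrite !comp_assoc (compV gg') (compV f'f).
Qed.

Lemma bang_T_id X : TmA L A X X (idm X) = idm (TA L A X).
Proof. exact: tens_id. Qed.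

Lemma bang_T_comp {X Y Z} (f : hom X Y) (g : hom Y Z) :
  TmA L A X Z (f >>> g) = TmA L A X Y f >>> TmA L A Y Z g.
Proof. exact: tens_compr. Qed.

Lemma bang_mu_nat {X Y} (f : hom X Y) :
  TmA L A _ _ (TmA L A X Y f) >>> muA L Ad A Y = muA L Ad A X >>> TmA L A X Y f.
Proof.
rewrite /TmA /muA; ca.
by rewrite (compA2 (assoc_inv_nat M _ _ _)) tens_id; ca; rewrite interchange.
Qed.

Lemma bang_eta_nat {X Y} (f : hom X Y) :
  f >>> etaA L Ad A Y = etaA L Ad A X >>> TmA L A X Y f.
Proof.
rewrite /TmA /etaA; ca.
by rewrite (compA2 (lu_inv_nat M _)) interchange; ca.
Qed.

Lemma bang_monad_assoc X :
  muA L Ad A (TA L A X) >>> muA L Ad A X = TmA L A _ _ (muA L Ad A X) >>> muA L Ad A X.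
Proof. by rewrite /muA /TmA /TA; strictify M S; rewrite strict_nabla_assoc. Qed.

Lemma bang_monad_unit1 X : etaA L Ad A (TA L A X) >>> muA L Ad A X = idm (TA L A X).
Proof.
rewrite /muA /etaA /TA; strictify M S.
by have h := nabla_unit_l L Ad A; strictify_in M S h (X ⊗ Z).
Qed.

Lemma bang_monad_unit2 X : TmA L A _ _ (etaA L Ad A X) >>> muA L Ad A X = idm (TA L A X).
Proof.
rewrite /muA /etaA /TA /TmA; strictify M S.
by have h := nabla_unit_r L Ad A; strictify_in M S h (X ⊗ Z).
Qed.

Lemma bang_n_nat {X X' Y Y'} (f : hom X X') (g : hom Y Y') :
  TmA L A _ _ (f ⊗m g) >>> nA L A X' Y' = nA L A X Y >>> (TmA L A _ _ f ⊗m TmA L A _ _ g).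
Proof.
by rewrite /nA /TmA; ca; rewrite -tau_nat tens_id; tens_merge.
Qed.

Lemma bang_n_assoc X Y Z :
  TmA L A _ _ (assoc M X Y Z) >>> nA L A X (Y ⊗ Z) >>> (idm (TA L A X) ⊗m nA L A Y Z)
  = nA L A (X ⊗ Y) Z >>> (nA L A X Y ⊗m idm (TA L A Z)) >>> assoc M _ _ _.
Proof.
rewrite /nA /TmA /TA tens_compr tens_compl; ca.
have t1 := tau_nat S (idm B) Δ (idm X) (idm (Y ⊗ Z)).
have t2 := tau_nat S Δ (idm B) (idm (X ⊗ Y)) (idm Z).
rewrite !tens_id in t1 t2.
rewrite (compA2 (esym t1)) (compA2 (esym t2)); ca; tens_merge.
rewrite -!cdup_coassoc.
rewrite -[X in (_ ⊗m X) >>> _ = _]comp_id_l tens_comp.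
by ca; rewrite (tau_assoc_inv S B B B X Y Z).
Qed.

Lemma bang_n_lunit X :
  nA L A K X >>> (nKA L A ⊗m idm (TA L A X)) >>> lu M (TA L A X) = TmA L A _ _ (lu M X).
Proof.
rewrite /nA /nKA /TA /TmA /tau; strictify M S.
by have h := cdup_lcounit _ L A; strictify_in M S h (X ⊗ Z).
Qed.

Lemma bang_n_runit X :
  nA L A X K >>> (idm (TA L A X) ⊗m nKA L A) >>> ru M (TA L A X) = TmA L A _ _ (ru M X).
Proof.
rewrite /nA /nKA /TA /TmA /tau; strictify M S.
have hs := sym_nat S e (idm X); strictify_in M S hs Z.
rewrite -tens_compr -hs.
by have h := cdup_rcounit _ L A; strictify_in M S h (X ⊗ Z).
Qed.

Lemma bang_n_sym X Y :
  TmA L A _ _ (sym S X Y) >>> nA L A Y X = nA L A X Y >>> sym S (TA L A X) (TA L A Y).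
Proof.
rewrite /nA /TmA; ca; rewrite -tau_sym; tens_merge.
by rewrite cdup_cocomm.
Qed.

(** This is the bialgebra law [nabla_cdup] whiskered by [X] and [Y]; [tau_assoc] reconciles the
    rearrangements of the factors. *)
Lemma bang_mu_comonoidal X Y :
  muA L Ad A (X ⊗ Y) >>> nA L A X Y
  = TmA L A _ _ (nA L A X Y) >>> nA L A (TA L A X) (TA L A Y)
    >>> (muA L Ad A X ⊗m muA L Ad A Y).
Proof.
rewrite /muA /nA /TmA /TA tens_comp; rewrite -> tens_compr; ca.
rewrite (compA2 (esym (tens_compl M _ _ _))) nabla_cdup; do 2! rewrite -> tens_compl; ca.
have t1 := tau_nat S ∇ ∇ (idm X) (idm Y); rewrite tens_id in t1.
rewrite t1 (compA2 (esym (assoc_inv_nat M _ _ _))); ca.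
rewrite (compA3 (tau_assoc S _ _ _ _ _ _)); ca.
rewrite (compA2 (esym (interchange M _ _))); ca.
by rewrite [in RHS](compA2 (esym (tens_comp _ _ _ _))) comp_id_l comp_id_r.
Qed.

Lemma bang_eta_comonoidal X Y :
  etaA L Ad A (X ⊗ Y) >>> nA L A X Y = etaA L Ad A X ⊗m etaA L Ad A Y.
Proof.
rewrite /etaA /nA; ca.
rewrite (compA2 (esym (tens_compl _ _ _ _))) u_cdup; rewrite -> tens_compl, tens_comp; ca.
have t1 := tau_nat S υ υ (idm X) (idm Y); rewrite tens_id in t1.
have h : lu_inv M (X ⊗ Y) >>> ((lu_inv M K ⊗m idm (X ⊗ Y)) >>> tau S K K X Y)
  = lu_inv M X ⊗m lu_inv M Y by rewrite /tau; strictify M S.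
by rewrite t1 (compA3 h).
Qed.

Lemma bang_mu_comonoidalK : muA L Ad A K >>> nKA L A = TmA L A _ _ (nKA L A) >>> nKA L A.
Proof.
rewrite /muA /nKA /TmA /TA; strictify M S.
by have h := nabla_e L Ad A; strictify_in M S h Z.
Qed.

Lemma bang_eta_comonoidalK : etaA L Ad A K >>> nKA L A = idm K.
Proof.
rewrite /etaA /nKA /TmA /TA; strictify M S.
by have h := u_e L Ad A; strictify_in M S h Z.
Qed.

Definition fusion_inv X Y : hom (TA L A X ⊗ TA L A Y) (TA L A (X ⊗ TA L A Y)) :=
  assoc M _ _ _ >>> (fusion σ X Y >>> assoc M _ _ _).

Lemma bang_fusionE X Y :
  nA L A X (TA L A Y) >>> (idm (TA L A X) ⊗m muA L Ad A Y) = fusion (idm B) X Y.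
Proof. by rewrite /nA /muA /TA /fusion; ca; rewrite !tens_id comp_id_l. Qed.

Lemma fusionK X Y :
  nA L A X (TA L A Y) >>> (idm (TA L A X) ⊗m muA L Ad A Y) >>> fusion_inv X Y = idm _.
Proof.
by rewrite bang_fusionE /fusion_inv (compA3 (fusion_comp _ _ _ _)) antipode_l fusion_unit.
Qed.

Lemma fusion_invK X Y :
  fusion_inv X Y >>> (nA L A X (TA L A Y) >>> (idm (TA L A X) ⊗m muA L Ad A Y)) = idm _.
Proof.
rewrite bang_fusionE /fusion_inv; ca; rewrite fusion_comp antipode_r.
apply: (iso_cancel_r _ _ _ _ (assoc_iso1 M _ _ _)).
by ca; rewrite fusion_unit comp_id_l comp_id_r.
Qed.

Lemma bang_fusion_left X Y :
  is_iso (nA L A X (TA L A Y) >>> (idm (TA L A X) ⊗m muA L Ad A Y)).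
Proof. by exists (fusion_inv X Y); rewrite fusionK fusion_invK. Qed.

(** By cocommutativity, in the form [bang_n_sym], the right fusion operator is the left one
    conjugated by symmetries. *)
Lemma bang_fusion_right X Y :
  is_iso (nA L A (TA L A X) Y >>> (muA L Ad A X ⊗m idm (TA L A Y))).
Proof.
have -> : nA L A (TA L A X) Y >>> (muA L Ad A X ⊗m idm (TA L A Y))
  = TmA L A _ _ (sym S _ _) >>> ((nA L A Y (TA L A X) >>> (idm (TA L A Y) ⊗m muA L Ad A X))
    >>> sym S _ _).
  ca; rewrite sym_nat (compA2 (bang_n_sym _ _)); ca.
  by rewrite (compV (sym_invol S _ _)).
apply: is_iso_comp; last apply: is_iso_comp (bang_fusion_left _ _) _.
- exists (TmA L A _ _ (sym S _ _)).
  by rewrite /TmA -!tens_compr !sym_invol !tens_id.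
- by exists (sym S _ _); rewrite !sym_invol.
Qed.

Lemma bang_lam_nat {X Y} (f : hom X Y) :
  TmA L A _ _ (!m f) >>> lamA L A Y = lamA L A X >>> !m (TmA L A X Y f).
Proof.
rewrite /TmA /lamA; ca; rewrite -mm_nat bang_id. by tens_merge.
Qed.

(** Each law of [lam] reflects a property of [!A]: here [∇] is a coalgebra map, for [η] the unit [υ]
    is one, for [mm] and [mK] the maps [Δ] and [e] are, and for [delta] and [eps] the comonad laws
    hold at [A]. *)
Lemma bang_lam_mu X :
  muA L Ad A (! X) >>> lamA L A X
  = TmA L A _ _ (lamA L A X) >>> lamA L A (TA L A X) >>> !m (muA L Ad A X).
Proof.
rewrite /TmA /lamA /muA /TA bang_comp; ca; tens_merge.
rewrite nabla_coalg /coalg_tens.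
rewrite -[X in X ⊗m (_ >>> _)]comp_id_r tens_comp; ca; rewrite (compA3 (mm_assoc_inv L _ _ _)); ca.
rewrite -mm_nat_l.
rewrite (compA2 (assoc_inv_nat M _ _ _)); ca.
by do 2! rewrite (compA2 (esym (tens_compl M _ _ _))); ca.
Qed.

Lemma bang_lam_eta X : etaA L Ad A (! X) >>> lamA L A X = !m (etaA L Ad A X).
Proof.
rewrite /lamA /etaA bang_comp; ca; tens_merge.
rewrite u_coalg; rewrite -> tens_compl; ca; rewrite mm_nat_l.
have -> : !m (lu_inv M X) = lu_inv M (! X) >>> ((mK L ⊗m idm (! X)) >>> mm L K X); last by ca.
apply: (iso_cancel_r (!m (lu M X)) (!m (lu_inv M X))).
  by rewrite -bang_comp lu_iso1 bang_id.
by ca; rewrite (compL3 (mm_lunit L _)) lu_iso2 -bang_comp lu_iso2 bang_id.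
Qed.

Lemma bang_lam_delta X :
  TmA L A _ _ (delta L X) >>> lamA L A (! X) >>> !m (lamA L A X)
  = lamA L A X >>> delta L (TA L A X).
Proof.
rewrite /TmA /lamA /TA bang_comp; ca; rewrite (compA2 (esym (mm_nat_l L _ _))) delta_monoidal.
by tens_merge; rewrite comonad_coassoc.
Qed.

Lemma bang_lam_eps X : lamA L A X >>> eps L (TA L A X) = TmA L A _ _ (eps L X).
Proof.
rewrite /TmA /lamA /TA; ca; rewrite eps_monoidal; tens_merge.
by rewrite comonad_counit1.
Qed.

Lemma bang_lam_mm X Y :
  nA L A (! X) (! Y) >>> (lamA L A X ⊗m lamA L A Y) >>> mm L (TA L A X) (TA L A Y)
  = TmA L A _ _ (mm L X Y) >>> lamA L A (X ⊗ Y) >>> !m (nA L A X Y).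
Proof.
rewrite /nA /TmA /lamA /TA tens_comp bang_comp; ca.
rewrite (compA2 (esym (mm_nat_l L _ _))) (compA2 (esym (tau_nat S _ _ _ _))) tens_id; ca.
by rewrite -mm_tau; tens_merge; rewrite -cdup_coalg; ca.
Qed.

Lemma bang_lam_mK : nKA L A >>> mK L = TmA L A _ _ (mK L) >>> lamA L A K >>> !m (nKA L A).
Proof.
rewrite /nKA /TmA /lamA /TA bang_comp; ca.
rewrite (compA2 (esym (interchange M _ _))); ca.
rewrite (compA3 (compL3 (mm_runit L _))) (compA2 (ru_nat _)); ca.
by rewrite cerase_coalg.
Qed.

(** With [bang_lam_cerase], this makes duplication and erasure maps of modules. Both hold because
    [δ] is a comonoid morphism. *)
Lemma bang_lam_cdup X :
  lamA L A X >>> cdup L (TA L A X)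
  = TmA L A _ _ (cdup L X) >>> (nA L A (! X) (! X) >>> (lamA L A X ⊗m lamA L A X)).
Proof.
rewrite /nA /TmA /lamA /TA tens_comp; ca.
rewrite cdup_monoidal (compA2 (esym (tau_nat S _ _ _ _))) tens_id; ca.
by tens_merge; rewrite delta_cdup.
Qed.

Lemma bang_lam_cerase X :
  lamA L A X >>> cerase L (TA L A X) = TmA L A _ _ (cerase L X) >>> nKA L A.
Proof.
rewrite /nKA /TmA /lamA /TA; ca; rewrite cerase_monoidal.
rewrite (compA2 (esym (tens_comp _ _ _ _))) delta_cerase comp_id_l.
by strictify M S.
Qed.
Theorem bang_monad_MELL :
  IsMELLLiftingMonad L (TA L A) (TmA L A) (muA L Ad A) (etaA L Ad A)
    (nA L A) (nKA L A) (lamA L A).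
Proof.
split.
- exact: bang_T_id.
- exact: @bang_T_comp.
- exact: @bang_mu_nat.
- exact: @bang_eta_nat.
- exact: bang_monad_assoc.
- exact: bang_monad_unit1.
- exact: bang_monad_unit2.
- exact: @bang_n_nat.
- exact: bang_n_assoc.
- exact: bang_n_lunit.
- exact: bang_n_runit.
- exact: bang_n_sym.
- exact: bang_mu_comonoidal.
- exact: bang_mu_comonoidalK.
- exact: bang_eta_comonoidal.
- exact: bang_eta_comonoidalK.
- exact: bang_fusion_left.
- exact: bang_fusion_right.
- exact: @bang_lam_nat.
- exact: bang_lam_mu.
- exact: bang_lam_eta.
- exact: bang_lam_delta.
- exact: bang_lam_eps.
- exact: bang_lam_mm.
- exact: bang_lam_mK.
Qed.
End BangMonadIsMELL.

(** * Modules and their symmetric monoidal structure *)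

Section Modules.
Context {C : Category} {M : MonoidalStr C} {S : SymmetryStr M} (L : ModalityStr S)
        (Ad : AdditiveStr M) (A : C).
Local Notation "A ⊗ B" := (tens M A B) (at level 30, right associativity).
Local Notation "f ⊗m g" := (tensm M f g) (at level 30, right associativity).
Local Notation K := (munit M).
Local Notation "! A" := (bang L A) (at level 20).
Local Notation "!m f" := (bangm L f) (at level 20).
Local Notation T := (TA L A).
Local Notation "'Tm' f" := (TmA L A _ _ f) (at level 20).
Local Notation μ := (muA L Ad A).
Local Notation η := (etaA L Ad A).
Local Notation n := (nA L A).
Local Notation λ := (lamA L A).
Local Notation MODA := (MOD L Ad A).

(** The module laws are convertible to the Eilenberg-Moore laws for [μ] and [η]. Stated in this form
    they combine directly with the laws of the monad. *)
Definition mk_mod (X : C) (x : hom (T X) X) (x_unit : η X >>> x = idm X)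
  (x_assoc : μ X >>> x = Tm x >>> x) : MODA :=
  @Build_ModOb C M (! A) (nablaA L Ad A) (uA L Ad A) X x x_unit x_assoc.

Definition mk_modhom (X Y : MODA) (f : hom (mcar X) (mcar Y))
  (f_comm : mact X >>> f = Tm f >>> mact Y) : hom X Y :=
  @Build_ModHom C M (! A) (nablaA L Ad A) (uA L Ad A) X Y f f_comm.

Lemma mod_unit_law (X : MODA) : η (mcar X) >>> mact X = idm _.
Proof. exact: mact_unit. Qed.

Lemma mod_assoc_law (X : MODA) : μ (mcar X) >>> mact X = Tm (mact X) >>> mact X.
Proof. exact: mact_assoc. Qed.

Lemma modhom_law {X Y : MODA} (f : hom X Y) : mact X >>> mhom f = Tm (mhom f) >>> mact Y.
Proof. exact: mhom_comm. Qed.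

Lemma modhom_inv (X Y : MODA) (f : hom (mcar X) (mcar Y)) (g : hom (mcar Y) (mcar X)) :
  f >>> g = idm _ -> g >>> f = idm _ ->
  mact X >>> f = Tm f >>> mact Y -> mact Y >>> g = Tm g >>> mact X.
Proof.
move=> fg gf cf; apply: (iso_cancel_r f g _ _ fg).
by ca; rewrite cf gf comp_id_r (compA2 (esym (bang_T_comp L A _ _))) gf bang_T_id comp_id_l.
Qed.

Section Tensor.
Context (X Y : MODA).
Let x := mact X.
Let y := mact Y.

Lemma mod_tens_unit : η (mcar X ⊗ mcar Y) >>> (n _ _ >>> (x ⊗m y)) = idm _.
Proof.
by rewrite (compA2 (bang_eta_comonoidal L Ad A _ _)) -tens_comp !mod_unit_law tens_id.
Qed.

Lemma mod_tens_assoc :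
  μ (mcar X ⊗ mcar Y) >>> (n _ _ >>> (x ⊗m y))
  = Tm (n _ _ >>> (x ⊗m y)) >>> (n _ _ >>> (x ⊗m y)).
Proof.
rewrite (compA2 (bang_mu_comonoidal L Ad A _ _)) bang_T_comp; ca.
rewrite -tens_comp !mod_assoc_law (compA2 (bang_n_nat L A _ _)); ca.
by rewrite -tens_comp.
Qed.

Definition mod_tens : MODA := mk_mod (mcar X ⊗ mcar Y) (n _ _ >>> (x ⊗m y))
  mod_tens_unit mod_tens_assoc.
End Tensor.

Lemma mod_tensm_comm {X Y X' Y' : MODA} (f : hom X X') (g : hom Y Y') :
  mact (mod_tens X Y) >>> (mhom f ⊗m mhom g) = Tm (mhom f ⊗m mhom g) >>> mact (mod_tens X' Y').
Proof.
rewrite /=; ca; rewrite (compA2 (bang_n_nat L A _ _)); ca.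
by rewrite -!tens_comp !modhom_law.
Qed.

Definition mod_tensm {X Y X' Y' : MODA} (f : hom X X') (g : hom Y Y') :
  hom (mod_tens X Y) (mod_tens X' Y') :=
  mk_modhom (mod_tens X Y) (mod_tens X' Y') (mhom f ⊗m mhom g) (mod_tensm_comm f g).

Definition mod_unit : MODA := mk_mod K (nKA L A)
  (bang_eta_comonoidalK L Ad A) (bang_mu_comonoidalK L Ad A).

Lemma mod_assoc_comm (X Y Z : MODA) :
  mact (mod_tens (mod_tens X Y) Z) >>> assoc M _ _ _
  = Tm (assoc M _ _ _) >>> mact (mod_tens X (mod_tens Y Z)).
Proof.
rewrite /=.
rewrite -[X in (_ >>> _) ⊗m X]comp_id_l tens_comp; ca; rewrite assoc_nat.
have -> : mact X ⊗m (n _ _ >>> (mact Y ⊗m mact Z))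
  = (idm _ ⊗m n (mcar Y) (mcar Z)) >>> (mact X ⊗m (mact Y ⊗m mact Z)).
  by rewrite -tens_comp comp_id_l.
by rewrite (compA3 (compL3 (bang_n_assoc L A _ _ _))); ca.
Qed.

Definition mod_assoc (X Y Z : MODA) :
  hom (mod_tens (mod_tens X Y) Z) (mod_tens X (mod_tens Y Z)) :=
  mk_modhom (mod_tens (mod_tens X Y) Z) (mod_tens X (mod_tens Y Z)) _ (mod_assoc_comm X Y Z).

Definition mod_assoc_inv (X Y Z : MODA) :
  hom (mod_tens X (mod_tens Y Z)) (mod_tens (mod_tens X Y) Z) :=
  mk_modhom (mod_tens X (mod_tens Y Z)) (mod_tens (mod_tens X Y) Z) _
    (modhom_inv (mod_tens (mod_tens X Y) Z) (mod_tens X (mod_tens Y Z)) _ _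
      (assoc_iso1 M _ _ _) (assoc_iso2 M _ _ _) (mod_assoc_comm X Y Z)).

Lemma mod_lu_comm (X : MODA) :
  mact (mod_tens mod_unit X) >>> lu M _ = Tm (lu M _) >>> mact X.
Proof.
rewrite /= -bang_n_lunit tens_split -interchange; ca.
by rewrite lu_nat.
Qed.

Lemma mod_ru_comm (X : MODA) :
  mact (mod_tens X mod_unit) >>> ru M _ = Tm (ru M _) >>> mact X.
Proof.
rewrite /= -bang_n_runit tens_split; ca.
by rewrite ru_nat.
Qed.

Definition mod_lu (X : MODA) : hom (mod_tens mod_unit X) X :=
  mk_modhom (mod_tens mod_unit X) X _ (mod_lu_comm X).

Definition mod_lu_inv (X : MODA) : hom X (mod_tens mod_unit X) :=
  mk_modhom X (mod_tens mod_unit X) _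
    (modhom_inv (mod_tens mod_unit X) X _ _ (lu_iso1 M _) (lu_iso2 M _) (mod_lu_comm X)).

Definition mod_ru (X : MODA) : hom (mod_tens X mod_unit) X :=
  mk_modhom (mod_tens X mod_unit) X _ (mod_ru_comm X).

Definition mod_ru_inv (X : MODA) : hom X (mod_tens X mod_unit) :=
  mk_modhom X (mod_tens X mod_unit) _
    (modhom_inv (mod_tens X mod_unit) X _ _ (ru_iso1 M _) (ru_iso2 M _) (mod_ru_comm X)).

(** All structure maps have those of [C] underneath, up to conversion, so [ModHom_ext] reduces each
    axiom to the same axiom in [C]. *)
Definition mod_monoidal : MonoidalStr MODA.
Proof.
refine (@Build_MonoidalStr MODA mod_tens (@mod_tensm) mod_unit mod_assoc mod_assoc_inv
  mod_lu mod_lu_inv mod_ru mod_ru_inv _ _ _ _ _ _ _ _ _ _ _ _ _);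
  intros; apply: ModHom_ext.
- exact: tens_id.
- exact: tens_comp.
- exact: assoc_nat.
- exact: lu_nat.
- exact: ru_nat.
- exact: assoc_iso1.
- exact: assoc_iso2.
- exact: lu_iso1.
- exact: lu_iso2.
- exact: ru_iso1.
- exact: ru_iso2.
- exact: pentagon.
- exact: triangle.
Defined.

Lemma mod_sym_comm (X Y : MODA) :
  mact (mod_tens X Y) >>> sym S _ _ = Tm (sym S _ _) >>> mact (mod_tens Y X).
Proof. by rewrite /=; ca; rewrite sym_nat (compA2 (bang_n_sym L A _ _)); ca. Qed.

Definition mod_sym (X Y : MODA) : hom (mod_tens X Y) (mod_tens Y X) :=
  mk_modhom (mod_tens X Y) (mod_tens Y X) _ (mod_sym_comm X Y).

Definition mod_symmetry : SymmetryStr mod_monoidal.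
Proof.
refine (@Build_SymmetryStr MODA mod_monoidal mod_sym _ _ _); intros; apply: ModHom_ext.
- exact: sym_nat.
- exact: sym_invol.
- exact: hexagon.
Defined.

(** Every clause holds by reflexivity, which relies on the two structures being transparent. *)
Lemma mod_lifted : IsLiftedSymMonoidal L Ad A mod_monoidal mod_symmetry.
Proof. by do ! split. Qed.

(* As [mact X] is split by the unit of the monad, invertibility of [mod_fusion] follows from
   that of the left fusion operator, which is the case of a free module [X]. *)
Section Hopf.
Context (X : MODA).
Local Notation x := (mact X).
Local Notation "'|X|'" := (mcar X).

Definition mod_fusion (Y : C) : hom (T (Y ⊗ |X|)) (T Y ⊗ |X|) :=
  n Y |X| >>> (idm (T Y) ⊗m x).

(** In elements, [(h ⊗ y) ⊗ x ↦ h₁ ⊗ (y ⊗ σ(h₂)x)], written through the inverse fusion operator at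
    the free module on [X]. *)
Definition mod_fusion_inv (Y : C) : hom (T Y ⊗ |X|) (T (Y ⊗ |X|)) :=
  (idm (T Y) ⊗m η |X|) >>> (fusion_inv L Ad A Y |X| >>> Tm (idm Y ⊗m x)).
Local Notation H := mod_fusion.

Lemma n_nat_r (Y : C) {Z Z'} (f : hom Z Z') :
  Tm (idm Y ⊗m f) >>> n Y Z' = n Y Z >>> (idm (T Y) ⊗m Tm f).
Proof. by rewrite bang_n_nat bang_T_id. Qed.

Lemma mod_fusion_nat {Y Z} (f : hom Y Z) : Tm (f ⊗m idm |X|) >>> H Z = H Y >>> (Tm f ⊗m idm |X|).
Proof.
rewrite /H (compA2 (bang_n_nat L A _ _)) bang_T_id; ca.
by rewrite interchange.
Qed.

Lemma mod_fusion_eta Y : η (Y ⊗ |X|) >>> H Y = η Y ⊗m idm |X|.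
Proof.
rewrite /H (compA2 (bang_eta_comonoidal L Ad A _ _)) -tens_comp comp_id_r.
by rewrite mod_unit_law.
Qed.

Lemma mod_fusion_mu Y :
  μ (Y ⊗ |X|) >>> H Y = Tm (H Y) >>> (H (T Y) >>> (μ Y ⊗m idm |X|)).
Proof.
rewrite /H (compA2 (bang_mu_comonoidal L Ad A _ _)) bang_T_comp; ca.
rewrite (compA2 (n_nat_r _ _)); ca.
rewrite -tens_comp comp_id_r mod_assoc_law.
do 2! congr (_ >>> _).
by rewrite -!tens_comp !comp_id_l !comp_id_r.
Qed.

Lemma mod_fusion_invK Y : mod_fusion_inv Y >>> H Y = idm _.
Proof.
rewrite /mod_fusion_inv /H; ca; rewrite (compA2 (n_nat_r _ _)); ca.
rewrite -tens_compr -mod_assoc_law; rewrite -> tens_compr.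
rewrite (compA3 (fusion_invK L Ad A _ _)) comp_id_l -tens_compr mod_unit_law.
exact: tens_id.
Qed.

(** The inverse is natural for all linear maps of free modules, not only those of the form [Tm g];
    [mod_fusionK] applies it to [μ]. *)
Lemma fusion_inv_nat (Y : C) {Z Z' : C} (f : hom (T Z) (T Z')) :
  μ Z >>> f = Tm f >>> μ Z' ->
  (idm (T Y) ⊗m f) >>> fusion_inv L Ad A Y Z' = fusion_inv L Ad A Y Z >>> Tm (idm Y ⊗m f).
Proof.
move=> fm; apply: (iso_cancel_r _ _ _ _ (fusionK L Ad A Y Z')).
ca; rewrite fusion_invK comp_id_r (compA2 (n_nat_r _ _)); ca.
rewrite -tens_compr -fm; rewrite -> tens_compr.
by rewrite (compA3 (fusion_invK L Ad A _ _)) comp_id_l.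
Qed.

Lemma mod_fusionK Y : H Y >>> mod_fusion_inv Y = idm _.
Proof.
rewrite /mod_fusion_inv /H; ca.
rewrite (compA2 (esym (tens_compr M _ _ _))) bang_eta_nat; rewrite -> tens_compr; ca.
rewrite (compA2 (fusion_inv_nat _ _ (esym (bang_mu_nat L Ad A _)))); ca.
(* Replacing [Tm x >>> x] by [μ >>> x] produces a [μ] that travels back through the inverse and
   cancels the unit [η]. *)
rewrite -bang_T_comp -tens_compr -mod_assoc_law; rewrite -> tens_compr; rewrite bang_T_comp.
rewrite (compA2 (esym (fusion_inv_nat _ _ (bang_monad_assoc L Ad A _)))); ca.
rewrite (compA2 (esym (tens_compr M _ _ _))) bang_monad_unit1 tens_id comp_id_l.
(* This exhibits the left fusion operator inside [n], ready to cancel against its inverse. *)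
have -> : n Y |X| = Tm (idm Y ⊗m η |X|) >>> (n Y (T |X|) >>> (idm (T Y) ⊗m μ |X|)).
  by rewrite (compA2 (n_nat_r _ _)); ca; rewrite -tens_compr bang_monad_unit2 tens_id comp_id_r.
ca; rewrite (compA3 (compL3 (fusionK L Ad A _ _))) comp_id_l -bang_T_comp -tens_compr.
by rewrite mod_unit_law tens_id bang_T_id.
Qed.
End Hopf.

(** * The closed structure on modules *)

Section Closed.
Context (Cl : ClosedStr M).

Lemma curry_ext {X Y Z : C} (f g : hom X (ihom Cl Y Z)) :
  (f ⊗m idm Y) >>> ev Cl Y Z = (g ⊗m idm Y) >>> ev Cl Y Z -> f = g.
Proof. by move=> e; rewrite (curry_uniq _ _ _ _ _ _ f e) -(curry_uniq _ _ _ _ _ _ g erefl). Qed.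

(** The usual action on the internal hom of Hopf modules, in elements [(h·f)(x) = h₁·f(σ(h₂)·x)]. *)
Definition hom_act (X Y : MODA) : hom (T (ihom Cl (mcar X) (mcar Y))) (ihom Cl (mcar X) (mcar Y)) :=
  curry Cl (mod_fusion_inv X _ >>> (Tm (ev Cl _ _) >>> mact Y)).

(** This is linearity of evaluation, and it determines the action since [mod_fusion] is invertible;
    the proofs below use it instead of the formula with the inverse. *)
Lemma hom_act_ev (X Y : MODA) :
  mod_fusion X _ >>> ((hom_act X Y ⊗m idm _) >>> ev Cl _ _) = Tm (ev Cl _ _) >>> mact Y.
Proof. by rewrite /hom_act curry_ev (compV (mod_fusionK _ _)). Qed.

Lemma hom_act_unit (X Y : MODA) : η _ >>> hom_act X Y = idm _.
Proof.
apply: curry_ext; rewrite tens_id comp_id_l; rewrite -> tens_compl; ca.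
rewrite -mod_fusion_eta; ca; rewrite hom_act_ev (compA2 (esym (bang_eta_nat L Ad A _))); ca.
by rewrite mod_unit_law comp_id_r.
Qed.

Lemma hom_act_assoc (X Y : MODA) : μ _ >>> hom_act X Y = Tm (hom_act X Y) >>> hom_act X Y.
Proof.
apply: curry_ext; rewrite -> !tens_compl; ca.
(* Precomposing with [mod_fusion], and below with its image under [Tm], brings both sides to the
   form where [mod_fusion_mu] and [hom_act_ev] apply. *)
apply: (iso_cancel_l _ _ _ _ (mod_fusion_invK X _)).
rewrite (compA2 (esym (mod_fusion_nat X _))); ca; rewrite hom_act_ev.
have e : Tm (mod_fusion_inv X (ihom Cl (mcar X) (mcar Y))) >>> Tm (mod_fusion X _) = idm _.
  by rewrite -bang_T_comp mod_fusion_invK bang_T_id.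
apply: (iso_cancel_l _ _ _ _ e).
rewrite (compA3 (esym (mod_fusion_mu X _))); ca; rewrite hom_act_ev.
rewrite (compA2 (esym (bang_T_comp L A _ _))) (compA2 (esym (bang_T_comp L A _ _))); ca.
rewrite hom_act_ev bang_T_comp; ca; rewrite -mod_assoc_law.
by rewrite (compA2 (bang_mu_nat L Ad A _)); ca.
Qed.

Definition mod_ihom (X Y : MODA) : MODA :=
  mk_mod _ (hom_act X Y) (hom_act_unit X Y) (hom_act_assoc X Y).

Lemma mod_ev_comm (X Y : MODA) :
  mact (mod_tens (mod_ihom X Y) X) >>> ev Cl (mcar X) (mcar Y) = Tm (ev Cl _ _) >>> mact Y.
Proof.
by rewrite /= -hom_act_ev /mod_fusion tens_split; ca.
Qed.

Definition mod_ev (X Y : MODA) : hom (mod_tens (mod_ihom X Y) X) Y :=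
  mk_modhom (mod_tens (mod_ihom X Y) X) Y _ (mod_ev_comm X Y).

Lemma mod_curry_comm (Z X Y : MODA) (f : hom (mod_tens Z X) Y) :
  mact Z >>> curry Cl (mhom f) = Tm (curry Cl (mhom f)) >>> mact (mod_ihom X Y).
Proof.
apply: curry_ext; rewrite -> !tens_compl; ca; rewrite curry_ev.
apply: (iso_cancel_l _ _ _ _ (mod_fusion_invK X _)).
rewrite (compA2 (esym (mod_fusion_nat X _))); ca; rewrite /= hom_act_ev.
rewrite (compA2 (esym (bang_T_comp L A _ _))) curry_ev -(modhom_law f) /= /mod_fusion; ca.
by rewrite (compA2 (esym (tens_comp _ _ _ _))) comp_id_l comp_id_r.
Qed.

Definition mod_curry {Z X Y : MODA} (f : hom (mod_tens Z X) Y) : hom Z (mod_ihom X Y) :=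
  mk_modhom Z (mod_ihom X Y) _ (mod_curry_comm Z X Y f).

Definition mod_closed : ClosedStr mod_monoidal.
Proof.
refine (@Build_ClosedStr MODA mod_monoidal mod_ihom mod_ev (@mod_curry) _ _).
- move=> X Y Z f; apply: ModHom_ext; exact: curry_ev.
- move=> X Y Z f g e; apply: ModHom_ext; apply: curry_uniq.
  by rewrite -e.
Defined.
End Closed.

(** * Lifting the monoidal coalgebra modality along [λ] *)

Lemma mod_bang_unit (X : MODA) : η (! (mcar X)) >>> (λ _ >>> !m (mact X)) = idm _.
Proof. by rewrite (compA2 (bang_lam_eta L Ad A _)) -bang_comp mod_unit_law bang_id. Qed.

Lemma mod_bang_assoc (X : MODA) :
  μ (! (mcar X)) >>> (λ _ >>> !m (mact X))
  = Tm (λ _ >>> !m (mact X)) >>> (λ _ >>> !m (mact X)).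
Proof.
rewrite (compA2 (bang_lam_mu L Ad A _)) bang_T_comp; ca.
rewrite -bang_comp mod_assoc_law bang_comp.
by rewrite (compA2 (bang_lam_nat L A _)); ca.
Qed.

Definition mod_bang (X : MODA) : MODA :=
  mk_mod _ (λ _ >>> !m (mact X)) (mod_bang_unit X) (mod_bang_assoc X).

Lemma mod_bangm_comm {X Y : MODA} (f : hom X Y) :
  mact (mod_bang X) >>> !m (mhom f) = Tm (!m (mhom f)) >>> mact (mod_bang Y).
Proof.
rewrite /=; ca; rewrite (compA2 (bang_lam_nat L A _)); ca.
by rewrite -!bang_comp modhom_law.
Qed.

Definition mod_bangm {X Y : MODA} (f : hom X Y) : hom (mod_bang X) (mod_bang Y) :=
  mk_modhom (mod_bang X) (mod_bang Y) _ (mod_bangm_comm f).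

Lemma mod_delta_comm (X : MODA) :
  mact (mod_bang X) >>> delta L _ = Tm (delta L _) >>> mact (mod_bang (mod_bang X)).
Proof.
rewrite /= bang_comp; ca.
by rewrite delta_nat (compA2 (esym (bang_lam_delta L A _))); ca.
Qed.

Definition mod_delta (X : MODA) : hom (mod_bang X) (mod_bang (mod_bang X)) :=
  mk_modhom (mod_bang X) (mod_bang (mod_bang X)) _ (mod_delta_comm X).

Lemma mod_eps_comm (X : MODA) : mact (mod_bang X) >>> eps L _ = Tm (eps L _) >>> mact X.
Proof. by rewrite /=; ca; rewrite eps_nat (compA2 (bang_lam_eps L A _)). Qed.

Definition mod_eps (X : MODA) : hom (mod_bang X) X :=
  mk_modhom (mod_bang X) X _ (mod_eps_comm X).

Lemma mod_mm_comm (X Y : MODA) :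
  mact (mod_tens (mod_bang X) (mod_bang Y)) >>> mm L _ _
  = Tm (mm L _ _) >>> mact (mod_bang (mod_tens X Y)).
Proof.
rewrite /= bang_comp tens_comp; ca.
by rewrite mm_nat (compA3 (compL3 (bang_lam_mm L A _ _))); ca.
Qed.

Definition mod_mm (X Y : MODA) :
  hom (mod_tens (mod_bang X) (mod_bang Y)) (mod_bang (mod_tens X Y)) :=
  mk_modhom (mod_tens (mod_bang X) (mod_bang Y)) (mod_bang (mod_tens X Y)) _ (mod_mm_comm X Y).

Lemma mod_mK_comm : mact mod_unit >>> mK L = Tm (mK L) >>> mact (mod_bang mod_unit).
Proof. by rewrite /= bang_lam_mK; ca. Qed.

Definition mod_mK : hom mod_unit (mod_bang mod_unit) :=
  mk_modhom mod_unit (mod_bang mod_unit) _ mod_mK_comm.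

Lemma mod_cdup_comm (X : MODA) :
  mact (mod_bang X) >>> cdup L _ = Tm (cdup L _) >>> mact (mod_tens (mod_bang X) (mod_bang X)).
Proof.
rewrite /= tens_comp; ca.
by rewrite cdup_nat (compA2 (bang_lam_cdup L A _)); ca.
Qed.

Definition mod_cdup (X : MODA) : hom (mod_bang X) (mod_tens (mod_bang X) (mod_bang X)) :=
  mk_modhom (mod_bang X) (mod_tens (mod_bang X) (mod_bang X)) _ (mod_cdup_comm X).

Lemma mod_cerase_comm (X : MODA) :
  mact (mod_bang X) >>> cerase L _ = Tm (cerase L _) >>> mact mod_unit.
Proof. by rewrite /=; ca; rewrite cerase_nat bang_lam_cerase. Qed.

Definition mod_cerase (X : MODA) : hom (mod_bang X) mod_unit :=
  mk_modhom (mod_bang X) mod_unit _ (mod_cerase_comm X).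

Definition mod_modality : ModalityStr mod_symmetry.
Proof.
refine (@Build_ModalityStr MODA mod_monoidal mod_symmetry mod_bang (@mod_bangm) _ _
  mod_delta mod_eps _ _ _ _ _ mod_mm mod_mK _ _ _ _ _ _ _ _ _ mod_cdup mod_cerase
  _ _ _ _ _ _ _ _ _ _ _ _ _ _); intros; apply: ModHom_ext.
- exact: bang_id.
- exact: bang_comp.
- exact: delta_nat.
- exact: eps_nat.
- exact: comonad_counit1.
- exact: comonad_counit2.
- exact: comonad_coassoc.
- exact: mm_nat.
- exact: mm_assoc.
- exact: mm_lunit.
- exact: mm_runit.
- exact: mm_sym.
- exact: eps_monoidal.
- exact: eps_monoidalK.
- exact: delta_monoidal.
- exact: delta_monoidalK.
- exact: cdup_nat.
- exact: cerase_nat.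
- exact: cdup_coassoc.
- exact: cdup_lcounit.
- exact: cdup_rcounit.
- exact: cdup_cocomm.
- exact: delta_cdup.
- exact: delta_cerase.
- exact: cdup_monoidal.
- exact: cdup_monoidalK.
- exact: cerase_monoidal.
- exact: cerase_monoidalK.
- exact: cdup_coalg.
- exact: cerase_coalg.
Defined.
End Modules.

Theorem theorem7p10 (C : Category) (M : MonoidalStr C) (S : SymmetryStr M)
  (Cl : ClosedStr M) (L : ModalityStr S) (Ad : AdditiveStr M) (A : C) :
  IsMELLLiftingMonad L (TA L A) (TmA L A) (muA L Ad A) (etaA L Ad A)
    (nA L A) (nKA L A) (lamA L A)
  /\ exists (M' : MonoidalStr (MOD L Ad A)) (S' : SymmetryStr M')
            (Cl' : ClosedStr M') (L' : ModalityStr S'),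
       IsLiftedSymMonoidal L Ad A M' S'.
Proof.
split; first exact: bang_monad_MELL.
exists (mod_monoidal L Ad A), (mod_symmetry L Ad A), (mod_closed L Ad A Cl), (mod_modality L Ad A).
exact: mod_lifted.
Qed.
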